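(* Let $(A,\mathfrak{m})$ be an abstract hypersurface ring of positive dimension. Then there exists a non-zero finite length $A$-module $M$ of finite projective dimension with $\ell\ell(M) = \lambda(M)$.
   Context: Local rings are Noetherian and commutative. A local ring $(A,\mathfrak{m})$ is an abstract hypersurface ring if its $\mathfrak{m}$-adic completion satisfies $\widehat{A} \cong Q/(f)$ for some complete regular local ring $(Q,\mathfrak{n})$ and some $f \in \mathfrak{n}$. For an $A$-module $M$ of finite length, $\lambda(M)$ denotes its length, and $\ell\ell(M)$ denotes its Loewy length, i.e., the smallest integer $c \geq 0$ such that $\mathfrak{m}^c M = 0$. *)

(* Defs.v *)
From HB Require Import structures.
From mathcomp Require Import all_boot all_algebra ring_quotient.
From mathcomp Require Import boolp.

Set Implicit Arguments.
Unset Strict Implicit.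
Unset Printing Implicit Defensive.
Import GRing.Theory.
Local Open Scope ring_scope.
Local Open Scope quotient_scope.

(* The library's [idealr R] is the type of proper ideals of R, as boolean      *)
(* predicates; by [boolp] every Prop-valued predicate has a boolean version,   *)
(* so this is no restriction.                                                  *)

Section StrictChains.
Variables (T : Type) (P : {pred T} -> Prop).

(* c 0 < c 1 < ... < c n, a chain of length n. *)
Definition strict_chain (n : nat) (c : nat -> {pred T}) : Prop :=
  (forall i, (i <= n)%N -> P (c i)) /\
  (forall i, (i < n)%N ->
     {subset c i <= c i.+1} /\ ~ {subset c i.+1 <= c i}).

Definition max_chain_length (n : nat) : Prop :=
  (exists c, strict_chain n c) /\
  (forall k, (exists c, strict_chain k c) -> (k <= n)%N).

End StrictChains.

Section Rings.
Variable R : comNzRingType.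
Implicit Types (I J m : idealr R) (S : {pred R}).

Definition generates S (k : nat) (g : 'I_k -> R) : Prop :=
  forall x, x \in S <-> exists c : 'I_k -> R, x = \sum_i c i * g i.

Definition noetherian : Prop :=
  forall I, exists k (g : 'I_k -> R), generates I g.

Definition maximal_ideal I : Prop :=
  forall J, {subset I <= J} -> {subset J <= I}.

Definition local_ring m : Prop :=
  [/\ noetherian, maximal_ideal m & forall J, maximal_ideal J -> J =i m].

Definition krull_dim (d : nat) : Prop :=
  max_chain_length
    (fun S : {pred R} => idealr_closed S /\ prime_idealr_closed S) d.

Definition embedding_dim m (d : nat) : Prop :=
  (exists g : 'I_d -> R, generates m g) /\
  (forall k (g : 'I_k -> R), generates m g -> (d <= k)%N).

Definition regular_local_ring m : Prop :=
  local_ring m /\ exists d, krull_dim d /\ embedding_dim m d.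

Definition ideal_prod S1 S2 : {pred R} :=
  [pred x | `[< exists k (a b : 'I_k -> R),
     [/\ forall i, a i \in S1, forall i, b i \in S2
       & x = \sum_i a i * b i] >]].

Fixpoint ideal_exp S (n : nat) : {pred R} :=
  if n is n'.+1 then ideal_prod S (ideal_exp S n') else predT.

Lemma ideal_exp_closed m n : idealr_closed (ideal_exp m n.+1).
Proof.
split=> [||a].
- apply/asboolP; exists 0, (fun=> 0), (fun=> 0).
  by split=> [[]|[]|] //; rewrite big_ord0.
- apply/negP => /asboolP[k [a [b [am _ e]]]].
  have : 1 \in m by rewrite e rpred_sum // => i _; rewrite mulrC idealMr.
  by rewrite idealr1.
move=> _ _ /asboolP[k [x [y [xm yI ->]]]] /asboolP[l [z [t [zm tI ->]]]].
apply/asboolP; exists (k + l)%N.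
exists (fun i => match split i with inl j => a * x j | inr j => z j end).
exists (fun i => match split i with inl j => y j | inr j => t j end).
split=> [i|i|]; [by case: split => j; rewrite ?idealMr|by case: split|].
rewrite big_split_ord mulr_sumr; congr (_ + _); apply: eq_bigr => i _.
  by rewrite (unsplitK (inl i)) mulrA.
by rewrite (unsplitK (inr i)).
Qed.

HB.instance Definition _ m n :=
  isIdealr.Build R (ideal_exp m n.+1) (ideal_exp_closed m n).

Lemma ideal_expS m n : {subset ideal_exp m n.+1 <= ideal_exp m n}.
Proof.
elim: n => [//|n IHn] _ /asboolP[k [a [b [am bI ->]]]].
by apply/asboolP; exists k, a, b; split=> // i; apply: IHn.
Qed.

End Rings.

Section Completion.
Variables (R : comNzRingType) (m : idealr R).

(* R / m^(n+1); the index is shifted because the library's quotients are by   *)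
(* proper ideals, and m^0 = R contributes nothing to the limit.               *)
Definition quot_exp (n : nat) : comNzRingType :=
  {ideal_quot (ideal_exp m n.+1 : idealr R)}.

Definition to_quot_exp (n : nat) (a : R) : quot_exp n :=
  \pi_({ideal_quot (ideal_exp m n.+1 : idealr R)}) a.

(* The canonical surjection R / m^(n+2) -> R / m^(n+1). *)
Definition transition (n : nat) (x : quot_exp n.+1) : quot_exp n :=
  to_quot_exp n (repr (x : {ideal_quot (ideal_exp m n.+2 : idealr R)})).

Lemma to_quot_exp_eq n a b :
  (to_quot_exp n a = to_quot_exp n b) <-> (a - b \in ideal_exp m n.+1).
Proof.
by split=> [/eqP|h]; [|apply/eqP]; rewrite /to_quot_exp -Quotient.idealrBE.
Qed.

Lemma to_quot_exp_surj n (x : quot_exp n) : exists a, x = to_quot_exp n a.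
Proof.
by exists (repr (x : {ideal_quot (ideal_exp m n.+1 : idealr R)})); rewrite /to_quot_exp reprK.
Qed.

Lemma transitionE n a : transition (to_quot_exp n.+1 a) = to_quot_exp n a.
Proof.
apply/to_quot_exp_eq; apply: ideal_expS; apply/to_quot_exp_eq.
by rewrite {1}/to_quot_exp reprK.
Qed.

Lemma to_quot_exp_is_zmod_morphism n : zmod_morphism (to_quot_exp n).
Proof. exact: (raddfB (\pi_({ideal_quot (ideal_exp m n.+1 : idealr R)}))). Qed.

Lemma to_quot_exp_is_monoid_morphism n : monoid_morphism (to_quot_exp n).
Proof.
by split=> [|a b]; [exact: rmorph1 (\pi_({ideal_quot (ideal_exp m n.+1 : idealr R)}))
  |exact: rmorphM (\pi_({ideal_quot (ideal_exp m n.+1 : idealr R)})) a b].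
Qed.

HB.instance Definition _ n := GRing.isZmodMorphism.Build R (quot_exp n)
  (to_quot_exp n) (to_quot_exp_is_zmod_morphism n).
HB.instance Definition _ n := GRing.isMonoidMorphism.Build R (quot_exp n)
  (to_quot_exp n) (to_quot_exp_is_monoid_morphism n).

Lemma transition_is_zmod_morphism n : zmod_morphism (@transition n).
Proof.
move=> x y; have [a ->] := to_quot_exp_surj x.
have [b ->] := to_quot_exp_surj y.
by rewrite -rmorphB !transitionE rmorphB.
Qed.

Lemma transition_is_monoid_morphism n : monoid_morphism (@transition n).
Proof.
split=> [|x y]; first by rewrite -(rmorph1 (to_quot_exp n.+1)) transitionE rmorph1.
have [a ->] := to_quot_exp_surj x; have [b ->] := to_quot_exp_surj y.
by rewrite -rmorphM !transitionE rmorphM.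
Qed.

HB.instance Definition _ n := GRing.isZmodMorphism.Build (quot_exp n.+1)
  (quot_exp n) (@transition n) (@transition_is_zmod_morphism n).
HB.instance Definition _ n := GRing.isMonoidMorphism.Build (quot_exp n.+1)
  (quot_exp n) (@transition n) (@transition_is_monoid_morphism n).

(* The inverse limit of the system ... -> R/m^3 -> R/m^2 -> R/m. *)
Record completion := Completion {
  coord :> forall n, quot_exp n;
  coord_coherent : forall n, transition (coord n.+1) = coord n }.

Lemma completionP (x y : completion) : (forall n, x n = y n) <-> x = y.
Proof.
split=> [|-> //]; case: x y => [x hx] [y hy] /= exy.
have e : x = y by exact: functional_extensionality_dep.
by case: y / e hy {exy} => hy; congr Completion; exact: Prop_irrelevance.
Qed.

HB.instance Definition _ := gen_eqMixin completion.
HB.instance Definition _ := gen_choiceMixin completion.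

Program Definition completion_zero := @Completion (fun=> 0) _.
Next Obligation. exact: rmorph0. Qed.
Program Definition completion_one := @Completion (fun=> 1) _.
Next Obligation. exact: rmorph1. Qed.
Program Definition completion_opp (x : completion) :=
  @Completion (fun n => - x n) _.
Next Obligation. by rewrite rmorphN /= coord_coherent. Qed.
Program Definition completion_add (x y : completion) :=
  @Completion (fun n => x n + y n) _.
Next Obligation. by rewrite rmorphD /= !coord_coherent. Qed.
Program Definition completion_mul (x y : completion) :=
  @Completion (fun n => x n * y n) _.
Next Obligation. by rewrite rmorphM /= !coord_coherent. Qed.

Fact completion_addA : associative completion_add.
Proof. by move=> x y z; apply/completionP => n /=; rewrite addrA. Qed.
Fact completion_addC : commutative completion_add.
Proof. by move=> x y; apply/completionP => n /=; rewrite addrC. Qed.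
Fact completion_add0 : left_id completion_zero completion_add.
Proof. by move=> x; apply/completionP => n /=; rewrite add0r. Qed.
Fact completion_addN : left_inverse completion_zero completion_opp completion_add.
Proof. by move=> x; apply/completionP => n /=; rewrite addNr. Qed.

HB.instance Definition _ := GRing.isZmodule.Build completion
  completion_addA completion_addC completion_add0 completion_addN.

Fact completion_mulA : associative completion_mul.
Proof. by move=> x y z; apply/completionP => n /=; rewrite mulrA. Qed.
Fact completion_mulC : commutative completion_mul.
Proof. by move=> x y; apply/completionP => n /=; rewrite mulrC. Qed.
Fact completion_mul1 : left_id completion_one completion_mul.
Proof. by move=> x; apply/completionP => n /=; rewrite mul1r. Qed.
Fact completion_mulDl : left_distributive completion_mul +%R.
Proof. by move=> x y z; apply/completionP => n /=; rewrite mulrDl. Qed.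
Fact completion_oner_neq0 : completion_one != 0.
Proof. by apply/eqP => /completionP/(_ 0)/eqP /=; rewrite oner_eq0. Qed.

HB.instance Definition _ := GRing.Zmodule_isComNzRing.Build completion
  completion_mulA completion_mulC completion_mul1 completion_mulDl
  completion_oner_neq0.

Program Definition to_completion (a : R) : completion :=
  @Completion (fun n => to_quot_exp n a) _.
Next Obligation. exact: transitionE. Qed.

Definition adically_complete : Prop := bijective to_completion.

End Completion.

Definition abstract_hypersurface (A : comNzRingType) (m : idealr A) : Prop :=
  local_ring m /\
  exists (Q : comNzRingType) (n : idealr Q) (f : Q) (I : idealr Q),
    [/\ regular_local_ring n, adically_complete n, f \in n,
        forall x, x \in I <-> exists q, x = q * f
      & exists phi : {rmorphism completion m -> {ideal_quot I}}, bijective phi].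

Section Modules.
Variables (R : comNzRingType).

Definition has_length (M : lmodType R) (l : nat) : Prop :=
  max_chain_length (@submod_closed R M) l.

Definition annihilated (S : {pred R}) (M : lmodType R) : Prop :=
  forall a (v : M), a \in S -> a *: v = 0.

Definition loewy_length (m : idealr R) (M : lmodType R) (c : nat) : Prop :=
  annihilated (ideal_exp m c) M /\
  (forall k, annihilated (ideal_exp m k) M -> (c <= k)%N).

Definition projective (P : lmodType R) : Prop :=
  forall (M N : lmodType R) (g : {linear M -> N}) (f : {linear P -> N}),
    (forall y, exists x, g x = y) ->
    exists h : {linear P -> M}, forall x, g (h x) = f x.

(* A projective resolution 0 -> P n -> ... -> P 1 -> P 0 -> M -> 0. *)
Definition finite_projective_dim (M : lmodType R) : Prop :=
  exists (n : nat) (P : nat -> lmodType R)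
         (d : forall i, {linear P i.+1 -> P i}) (e : {linear P 0%N -> M}),
    [/\ forall i, projective (P i),
        forall i, (n < i)%N -> forall x : P i, x = 0,
        forall y, exists x, e x = y,
        forall x, e x = 0 <-> exists y, d 0%N y = x
      & forall i x, d i x = 0 <-> exists y, d i.+1 y = x].

End Modules.

(* Main.v *)
(* By Krull's theorems a regular local ring Q with maximal ideal (x_1..x_D)   *)
(* has all its ideals (x_1..x_i) prime, for every minimal system of           *)
(* generators.  Writing the completion of A as Q / (f) with f != 0, one       *)
(* changes x_1..x_(D-1) successively into elements y_i := x_i - x_D^j, lifted *)
(* from A, so that f is not in the prime ideal (y).  Then Q / (y) is a        *)
(* discrete valuation ring, in which f is a unit times a power of x_D, and y  *)
(* is regular modulo f.  Krull's intersection theorem descends both facts     *)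
(* from the completion to A: M := A / (y) is resolved by a Koszul complex,    *)
(* and its maximal ideal is principal and nilpotent, so M is uniserial.  If f *)
(* = 0 one takes M := A / (x_1..x_D) instead.                                 *)

Require Import Defs.
From HB Require Import structures.
From mathcomp Require Import all_boot all_algebra ring_quotient.
From mathcomp Require Import boolp ring zify.

Set Implicit Arguments.
Unset Strict Implicit.
Unset Printing Implicit Defensive.
Import GRing.Theory.
Local Open Scope ring_scope.

(** Let Q/(f) be the completion of A, n the maximal ideal of Q and D the dimension of Q. It suffices
    to find in A a regular sequence y and an element t with m = (t, y) and a power of t in (y); this
    is [abstract_hypersurface_system]. Iterated mapping cones then resolve A/(y)
    ([regular_seq_resolution]). Modulo y every element is a unit times a power of t, or zero, so
    both the length and the Loewy length of A/(y) are the least l with t^l in (y)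
    ([uniserial_length], [uniserial_loewy_length]).

    In Q, part of a minimal system of generators of n generates a prime ideal
    ([span_regular_prime]), a consequence of the principal ideal theorem. If f is non-zero,
    [avoid_step] changes the generators so that f stays outside the prime (s) generated by D - 1 of
    them. Modulo s the last generator T is a uniformizer, so a power of T lies in (s, f)
    ([power_in_span]), and primality of the ideals generated by parts of s makes s regular modulo f
    ([regular_mod_generators]). If f = 0, all D generators go into s and T = 0 serves.

    These changes keep the generators among the elements of Q that agree modulo f with an element of
    A. [lifts_generate] supplies generators of this kind, while [lifts_ascend] and [lifts_descend]
    carry ideal membership between A and Q, with Krull's intersection theorem in the role of
    faithful flatness. *)

Section Ideals.
Variable R : comNzRingType.
Implicit Types (I J K P S : R -> Prop) (a b r x y : R) (s t : seq R).

(** * Ideals, generated ideals and their powers *)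

Definition sub_ideal I J := forall x, I x -> J x.

Record is_ideal I : Prop := IsIdeal {
  ideal0 : I 0;
  idealD : forall x y, I x -> I y -> I (x + y);
  idealM : forall a x, I x -> I (a * x) }.

Record is_prime P : Prop := IsPrime {
  prime_ideal : is_ideal P;
  prime_proper : ~ P 1;
  prime_mul : forall x y, P (x * y) -> P x \/ P y }.

Lemma idealMl I a x : is_ideal I -> I x -> I (x * a).
Proof. by move=> hI Ix; rewrite mulrC; apply: idealM. Qed.

Lemma idealN I x : is_ideal I -> I x -> I (- x).
Proof. by move=> hI Ix; rewrite -mulN1r; apply: idealM. Qed.

Lemma idealB I x y : is_ideal I -> I x -> I y -> I (x - y).
Proof. by move=> hI Ix Iy; apply: idealD => //; apply: idealN. Qed.

Lemma idealBr I x y : is_ideal I -> I (x + y) -> I y -> I x.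
Proof. by move=> hI Ixy Iy; rewrite -(addrK y x); apply: idealB. Qed.

Lemma ideal_sum I k (F : 'I_k -> R) :
  is_ideal I -> (forall i, I (F i)) -> I (\sum_i F i).
Proof.
by move=> hI IF; apply: big_ind => //; [apply: ideal0|apply: idealD].
Qed.

Definition add_ideal I J x := exists a b, [/\ I a, J b & x = a + b].
Definition principal x y := exists r, y = r * x.

Lemma principal_ideal x : is_ideal (principal x).
Proof.
split=> [|_ _ [r ->] [t ->]|a _ [r ->]]; first by exists 0; rewrite mul0r.
  by exists (r + t); rewrite mulrDl.
by exists (a * r); rewrite mulrA.
Qed.

Lemma principal_id x : principal x x.
Proof. by exists 1; rewrite mul1r. Qed.

Lemma add_ideal_ideal I J : is_ideal I -> is_ideal J -> is_ideal (add_ideal I J).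
Proof.
move=> hI hJ; split.
- by exists 0, 0; split; [apply: ideal0|apply: ideal0|rewrite addr0].
- move=> _ _ [a [b [Ia Jb ->]]] [c [d [Ic Jd ->]]].
  by exists (a + c), (b + d); split; [apply: idealD|apply: idealD|rewrite addrACA].
move=> r _ [a [b [Ia Jb ->]]].
by exists (r * a), (r * b); split; [apply: idealM|apply: idealM|rewrite mulrDr].
Qed.

Lemma add_idealL I J : is_ideal J -> sub_ideal I (add_ideal I J).
Proof. by move=> hJ x Ix; exists x, 0; split; rewrite ?addr0 //; apply: ideal0. Qed.

Lemma add_idealR I J : is_ideal I -> sub_ideal J (add_ideal I J).
Proof. by move=> hJ x Ix; exists 0, x; split; rewrite ?add0r //; apply: ideal0. Qed.

Lemma add_ideal_sub I J K : is_ideal K -> sub_ideal I K -> sub_ideal J K ->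
  sub_ideal (add_ideal I J) K.
Proof. by move=> hK IK JK _ [a [b [/IK Ka /JK Kb ->]]]; apply: idealD. Qed.

Variant ideal_gen S x : Prop :=
  IdealGen of (forall I, is_ideal I -> sub_ideal S I -> I x).

Lemma ideal_gen_sub S I : is_ideal I -> sub_ideal S I -> sub_ideal (ideal_gen S) I.
Proof. by move=> hI SI x [h]; apply: h. Qed.

Lemma ideal_gen_ideal S : is_ideal (ideal_gen S).
Proof.
split=> [|x y [hx] [hy]|a x [hx]]; split=> I hI SI; first exact: ideal0.
  by apply: idealD => //; [apply: hx|apply: hy].
by apply: idealM => //; apply: hx.
Qed.

Lemma ideal_gen_id S : sub_ideal S (ideal_gen S).
Proof. by move=> x Sx; split=> I _; apply. Qed.

Definition span s := ideal_gen (fun x => x \in s).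

Lemma span_ideal s : is_ideal (span s).
Proof. exact: ideal_gen_ideal. Qed.

Lemma mem_span s x : x \in s -> span s x.
Proof. exact: ideal_gen_id. Qed.

Lemma span_sub s I : is_ideal I -> (forall x, x \in s -> I x) ->
  sub_ideal (span s) I.
Proof. exact: ideal_gen_sub. Qed.

Lemma span_mono s t : {subset s <= t} -> sub_ideal (span s) (span t).
Proof.
move=> st; apply: span_sub; first exact: span_ideal.
by move=> x /st; apply: mem_span.
Qed.

Lemma span_nil x : span [::] x -> x = 0.
Proof.
have h : is_ideal (fun y : R => y = 0).
  by split=> // [_ _ -> ->|a _ ->]; rewrite ?addr0 ?mulr0.
by move=> hx; apply: (span_sub h) hx => y; rewrite in_nil.
Qed.

Lemma span_cons g s x :
  span (g :: s) x <-> exists r b, span s b /\ x = r * g + b.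
Proof.
split=> [|[r [b [sb ->]]]].
  have h : is_ideal (fun y => exists r b, span s b /\ y = r * g + b).
    have hs := span_ideal s; split.
    - by exists 0, 0; split; [apply: ideal0|rewrite mul0r addr0].
    - move=> _ _ [r [b [sb ->]]] [r' [b' [sb' ->]]]; exists (r + r'), (b + b').
      by split; [apply: idealD|ring].
    move=> a _ [r [b [sb ->]]]; exists (a * r), (a * b).
    by split; [apply: idealM|ring].
  move=> hx; apply: (span_sub h) hx => y; rewrite inE => /orP[/eqP->|ys].
    by exists 1, 0; split; [exact: (ideal0 (span_ideal s))|ring].
  by exists 0, y; split; [apply: mem_span|ring].
apply: idealD; first exact: span_ideal.
  by apply: idealM; [apply: span_ideal|apply/mem_span/mem_head].
by apply: span_mono sb => y ys; rewrite inE ys orbT.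
Qed.

Lemma span_codom k (g : 'I_k -> R) x :
  span (codom g) x <-> exists c : 'I_k -> R, x = \sum_i c i * g i.
Proof.
split=> [|[c ->]].
  have h : is_ideal (fun y => exists c : 'I_k -> R, y = \sum_i c i * g i).
    split.
    - by exists (fun=> 0); rewrite big1 // => i _; rewrite mul0r.
    - move=> _ _ [c ->] [d ->]; exists (fun i => c i + d i).
      by rewrite -big_split; apply: eq_bigr => i _; rewrite mulrDl.
    move=> a _ [c ->]; exists (fun i => a * c i).
    by rewrite mulr_sumr; apply: eq_bigr => i _; rewrite mulrA.
  move=> hx; apply: (span_sub h) hx => y /codomP[i ->].
  exists (fun j => (j == i)%:R); rewrite (bigD1 i) //= eqxx mul1r big1 ?addr0 //.
  by move=> j /negPf ->; rewrite mul0r.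
apply: ideal_sum => [|i]; first exact: span_ideal.
by apply: idealM; [apply: span_ideal|apply/mem_span/codom_f].
Qed.

Lemma generates_span (S : {pred R}) k (g : 'I_k -> R) :
  generates S g <-> forall x, x \in S <-> span (codom g) x.
Proof.
by split=> h x; rewrite h span_codom.
Qed.

Lemma span_generates (S : {pred R}) s : (forall x, x \in S <-> span s x) ->
  generates S (fun i : 'I_(size s) => s`_i).
Proof.
move=> h; apply/generates_span => x; rewrite h.
suff e : codom (fun i : 'I_(size s) => s`_i) =i s.
  by split; apply: span_mono => y; rewrite e.
move=> y; apply/codomP/idP => [[i ->]|ys]; first exact: mem_nth.
have hi : (index y s < size s)%N by rewrite index_mem.
by exists (Ordinal hi); rewrite /= nth_index.
Qed.

Definition prod_ideal I J := ideal_gen (fun x => exists a b, [/\ I a, J b & x = a * b]).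

Lemma prod_ideal_ideal I J : is_ideal (prod_ideal I J).
Proof. exact: ideal_gen_ideal. Qed.

Lemma prod_ideal_mem I J a b : I a -> J b -> prod_ideal I J (a * b).
Proof. by move=> Ia Jb; apply: ideal_gen_id; exists a, b. Qed.

Fixpoint ideal_pow I n : R -> Prop :=
  if n is n'.+1 then prod_ideal I (ideal_pow I n') else fun=> True.

Lemma ideal_pow_ideal I n : is_ideal (ideal_pow I n).
Proof. by case: n => [|n]; [split|apply: ideal_gen_ideal]. Qed.

Lemma ideal_powS I n a b : I a -> ideal_pow I n b -> ideal_pow I n.+1 (a * b).
Proof. by move=> Ia hb; apply: prod_ideal_mem. Qed.

Lemma ideal_pow_exp I n a : I a -> ideal_pow I n (a ^+ n).
Proof.
by move=> Ia; elim: n => // n IHn; rewrite exprS; apply: ideal_powS.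
Qed.

Lemma ideal_pow_le I n k : (n <= k)%N -> sub_ideal (ideal_pow I k) (ideal_pow I n).
Proof.
move=> /subnK <-; elim: (k - n)%N => // {}k IH x hx; apply: IH.
apply: (ideal_gen_sub _ _ hx); first exact: ideal_pow_ideal.
by move=> _ [a [b [_ hb ->]]]; apply: idealM => //; apply: ideal_pow_ideal.
Qed.

Lemma ideal_pow_add I n k J : is_ideal J ->
  (forall x y, ideal_pow I n x -> ideal_pow I k y -> J (x * y)) ->
  sub_ideal (ideal_pow I (n + k)) J.
Proof.
move=> + + x; elim: n J x => [|n IHn] J x hJ h.
  by move=> hx; rewrite -(mul1r x); apply: h.
move=> hx; apply: (ideal_gen_sub _ _ hx) => // _ [a [b [Ia hb ->]]].
(* The induction passes from J to the colon ideal of J by a, which is why J varies. *)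
apply: (IHn (fun z => J (a * z))) hb.
  split; first by rewrite mulr0; apply: ideal0.
    by move=> u v Ju Jv; rewrite mulrDr; apply: idealD.
  by move=> u v Jv; rewrite mulrCA; apply: idealM.
by move=> u v hu hv; rewrite mulrA; apply: h => //; apply: ideal_powS.
Qed.

Lemma ideal_expP (m : {pred R}) n x :
  x \in ideal_exp m n <-> ideal_pow (fun y => y \in m) n x.
Proof.
elim: n x => [//|n IHn] x; split=> [/asboolP[k [a [b [am bm ->]]]]|].
  apply: ideal_sum => [|i]; first exact: ideal_pow_ideal.
  by apply: ideal_powS => //; apply/IHn.
move=> hx.
apply: (@ideal_gen_sub _ (fun z => z \in ideal_exp m n.+1) _ _ _ hx); last first.
  move=> _ [a [b [am bm ->]]]; apply/asboolP; exists 1%N, (fun=> a), (fun=> b).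
  by rewrite big_ord1; split=> // _; apply/IHn.
split; first by apply/asboolP; exists 0%N, (fun=> 0), (fun=> 0);
  split; [case|case|rewrite big_ord0].
  move=> _ _ /asboolP[k [a [b [am bm ->]]]] /asboolP[l [c [d [cm dm ->]]]].
  apply/asboolP; exists (k + l)%N.
  exists (fun i => match split i with inl j => a j | inr j => c j end).
  exists (fun i => match split i with inl j => b j | inr j => d j end).
  split=> [i|i|]; [by case: split|by case: split|].
  rewrite big_split_ord; congr (_ + _); apply: eq_bigr => i _.
    by rewrite (unsplitK (inl i)).
  by rewrite (unsplitK (inr i)).
move=> r _ /asboolP[k [a [b [am bm ->]]]]; apply/asboolP.
exists k, a, (fun i => r * b i); split=> // [i|].
  by apply/IHn/(idealM (ideal_pow_ideal _ _))/IHn.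
by rewrite mulr_sumr; apply: eq_bigr => i _; rewrite mulrCA.
Qed.

(** * Noetherian rings *)

Definition is_noetherian := forall I, is_ideal I -> exists s,
  forall x, I x <-> span s x.

Lemma idealr_is_ideal (I : idealr R) : is_ideal (fun x => x \in I).
Proof.
split=> [|x y|a x]; [exact: rpred0|exact: rpredD|exact: idealMr].
Qed.

Lemma is_ideal_closed I : is_ideal I -> ~ I 1 ->
  idealr_closed (fun x => `[< I x >] : bool).
Proof.
move=> hI I1; split; first exact: (asboolT (ideal0 hI)).
  by apply/negP => /asboolP.
move=> a x y /asboolP Ix /asboolP Iy; apply/asboolP.
by apply: idealD => //; apply: idealM.
Qed.

Lemma is_ideal_idealr I : is_ideal I -> ~ I 1 ->
  exists J : idealr R, forall x, x \in J <-> I x.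
Proof.
move=> hI I1; pose S : R -> bool := fun x => `[< I x >].
pose J : idealr R := HB.pack S (isIdealr.Build R S (is_ideal_closed hI I1)).
exists J => x; split; first by move/asboolP.
by move=> Ix; apply/asboolP.
Qed.

Lemma noetherianW : noetherian R -> is_noetherian.
Proof.
move=> hR I hI; have [I1|I1] := pselect (I 1).
  exists [:: 1] => x; split=> _; rewrite -(mulr1 x); apply: idealM => //.
    exact: span_ideal.
  exact/mem_span/mem_head.
have [J hJ] := is_ideal_idealr hI I1; have [k [g /generates_span hg]] := hR J.
by exists (codom g) => x; rewrite -hJ hg.
Qed.

Hypothesis noethR : is_noetherian.

(** Otherwise choice yields a strictly increasing sequence in C; the union is finitely generated,
    and its generators all occur at one finite stage. *)
Lemma noetherian_max (C : (R -> Prop) -> Prop) :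
  (forall I, C I -> is_ideal I) -> (exists I, C I) ->
  exists2 J, C J & forall K, C K -> sub_ideal J K -> sub_ideal K J.
Proof.
move=> Cideal [I0 CI0]; apply: contrapT => h.
have next (J : {J | C J}) : exists K : {K | C K},
    sub_ideal (sval J) (sval K) /\ ~ sub_ideal (sval K) (sval J).
  case: J => J CJ /=; apply: contrapT => hK; apply: h; exists J => // K CK JK.
  by apply: contrapT => hKJ; apply: hK; exists (exist _ K CK).
have [F hF] := choice next.
pose U n := sval (iter n F (exist _ I0 CI0)).
have UC n : C (U n) by rewrite /U; case: (iter n F _).
have Uid n : is_ideal (U n) by exact/Cideal.
have Ule n k : (n <= k)%N -> sub_ideal (U n) (U k).
  move=> /subnK <-; elim: (k - n)%N => // {}k IH x /IH.
  by rewrite addSn; apply: (hF _).1.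
have hV : is_ideal (fun x => exists n, U n x).
  split; first by exists 0%N; apply: ideal0.
    move=> x y [n nx] [k ky]; exists (maxn n k); apply: idealD => //.
      exact: Ule (leq_maxl _ _) _ nx.
    exact: Ule (leq_maxr _ _) _ ky.
  by move=> a x [n nx]; exists n; apply: idealM.
have [s hs] := noethR hV.
have [n hn] : exists n, forall x, x \in s -> U n x.
  have : forall x, x \in s -> exists n, U n x by move=> x xs; apply/hs/mem_span.
  elim: s {hs} => [|g s IH] h1; first by exists 0%N.
  have [|n hn] := IH; first by move=> x xs; apply: h1; rewrite inE xs orbT.
  have [k hk] := h1 g (mem_head _ _); exists (maxn n k) => x.
  rewrite inE => /orP[/eqP->|xs]; first exact: Ule (leq_maxr _ _) _ hk.
  exact: Ule (leq_maxl _ _) _ (hn _ xs).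
apply: (hF (iter n F (exist _ I0 CI0))).2 => x hx.
have sx : span s x by apply/hs; exists n.+1.
exact: (span_sub (Uid n) hn) sx.
Qed.

Lemma noetherian_ind (C : (R -> Prop) -> Prop) :
  (forall I, is_ideal I ->
     (forall J, is_ideal J -> sub_ideal I J -> ~ sub_ideal J I -> C J) -> C I) ->
  forall I, is_ideal I -> C I.
Proof.
move=> h I hI; apply: contrapT => nCI.
have [||J [hJ nCJ] Jmax] := @noetherian_max (fun K => is_ideal K /\ ~ C K).
- by move=> K [].
- by exists I.
apply: nCJ; apply: h => // K hK JK nKJ; apply: contrapT => nCK.
by apply: nKJ; apply: Jmax.
Qed.

(* A P-saturated ideal is the contraction of an ideal of the localization at  *)
(* P, so statements about saturated ideals replace arguments in R_P.          *)
Definition saturated P I := forall r a, ~ P r -> I (r * a) -> I a.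

(** * Nakayama's lemma and saturation at a prime *)

Lemma prod_span_cons P g s x : is_ideal P -> prod_ideal P (span (g :: s)) x ->
  exists p b, [/\ P p, prod_ideal P (span s) b & x = p * g + b].
Proof.
have hs := prod_ideal_ideal P (span s); move=> hP.
have hJ : is_ideal (fun x => exists p b,
    [/\ P p, prod_ideal P (span s) b & x = p * g + b]).
  split; first by exists 0, 0; split; [exact: ideal0|exact: ideal0|ring].
    move=> _ _ [p [b [Pp hb ->]]] [q [c [Pq hc ->]]].
    by exists (p + q), (b + c); split; [exact: idealD|exact: idealD|ring].
  move=> a _ [p [b [Pp hb ->]]].
  by exists (a * p), (a * b); split; [exact: idealM|exact: idealM|ring].
move=> hx; apply: (ideal_gen_sub hJ _ hx) => _ [p [_ [Pp /span_cons[r [b [sb ->]]] ->]]].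
exists (p * r), (p * b).
by split; [exact: idealMl|exact: prod_ideal_mem|ring].
Qed.

(** Nakayama's lemma over the localization at P. Generators are eliminated one at a time: a relation
    r g = c + p g + b gives (r - p) g = c + b with r - p outside P. *)
Lemma nakayama P I s : is_prime P -> is_ideal I -> saturated P I ->
  (forall x, x \in s -> exists2 r, ~ P r &
     add_ideal I (prod_ideal P (span s)) (r * x)) ->
  sub_ideal (span s) I.
Proof.
move=> [hP P1 Pmul] hI satI; elim: s => [|g s IHs] h.
  by move=> x /span_nil ->; apply: ideal0.
have [r Pr [c [_ [Ic /(prod_span_cons hP) [p [b [Pp hb ->]]] e]]]] := h g (mem_head _ _).
have Prp : ~ P (r - p) by move=> Prp; apply: Pr; rewrite -(subrK p r); apply: idealD.
have eg : (r - p) * g = c + b by rewrite mulrBl e; ring.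
(* Multiplying the relation of x by r - p and substituting for (r - p) g removes g from it. *)
have sI : sub_ideal (span s) I.
  apply: IHs => x xs; have [|r' Pr' hr'] := h x; first by rewrite inE xs orbT.
  case: hr' => c' [_ [Ic' /(prod_span_cons hP) [p' [b' [Pp' hb' ->]]] e']].
  exists ((r - p) * r'); first by move=> /Pmul[].
  exists ((r - p) * c' + p' * c), ((r - p) * b' + p' * b); split.
  - by apply: idealD; [|apply: idealM|apply: idealM].
  - have hs := prod_ideal_ideal P (span s).
    by apply: idealD; [|apply: idealM|apply: idealM].
  rewrite -mulrA e'; transitivity ((r - p) * c' + p' * ((r - p) * g) + (r - p) * b').
    by ring.
  by rewrite eg; ring.
have Ig : I g.
  apply: (satI (r - p)) => //; rewrite eg; apply: idealD => //.
  apply: (ideal_gen_sub _ _ hb) => // _ [u [v [_ /sI Iv ->]]]; exact: idealM.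
apply: span_sub => // x; rewrite inE => /orP[/eqP-> //|xs].
by apply: sI; apply: mem_span.
Qed.


Definition saturation P I a := exists2 r, ~ P r & I (r * a).

Lemma saturation_ideal P I : is_prime P -> is_ideal I -> is_ideal (saturation P I).
Proof.
move=> [hP P1 Pmul] hI; split.
- by exists 1; rewrite ?mulr0 //; apply: ideal0.
- move=> x y [r Pr Irx] [t Pt Ity]; exists (r * t); first by move=> /Pmul[].
  have -> : r * t * (x + y) = r * x * t + r * (t * y) by ring.
  by apply: idealD => //; [apply: idealMl|apply: idealM].
by move=> a x [r Pr Irx]; exists r; rewrite // mulrCA; apply: idealM.
Qed.

Lemma sub_saturation P I : is_prime P -> sub_ideal I (saturation P I).
Proof. by move=> [_ P1 _] x Ix; exists 1; rewrite ?mul1r. Qed.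

Lemma saturationS P I J : sub_ideal I J -> sub_ideal (saturation P I) (saturation P J).
Proof. by move=> IJ x [r Pr /IJ Jrx]; exists r. Qed.

Lemma saturation_saturated P I : is_prime P -> saturated P (saturation P I).
Proof.
move=> [hP P1 Pmul] r a Pr [t Pt Itra]; exists (t * r); first by move=> /Pmul[].
by rewrite -mulrA.
Qed.

Lemma saturation_sub P I J : saturated P J -> sub_ideal I J ->
  sub_ideal (saturation P I) J.
Proof. by move=> satJ IJ x [r Pr /IJ]; apply: satJ. Qed.

Lemma saturatedS P Q I : sub_ideal P Q -> saturated P I -> saturated Q I.
Proof. by move=> PQ satI r a Qr; apply: satI => /PQ. Qed.

Lemma prime_saturated P Q : is_prime Q -> sub_ideal Q P -> saturated P Q.
Proof. by move=> [_ _ Qmul] QP r a Pr /Qmul[/QP|]. Qed.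

Lemma add_idealS I J K : sub_ideal I J -> sub_ideal (add_ideal I K) (add_ideal J K).
Proof. by move=> IJ _ [a [b [/IJ Ja Kb ->]]]; exists a, b. Qed.

Lemma colon_ideal I g : is_ideal I -> is_ideal (fun z => I (z * g)).
Proof.
move=> hI; split=> [|x y Ix Iy|a x Ix]; first by rewrite mul0r; apply: ideal0.
  by rewrite mulrDl; apply: idealD.
by rewrite -mulrA; apply: idealM.
Qed.

Lemma prime_exp P x k : is_prime P -> P (x ^+ k) -> P x.
Proof.
move=> [_ P1 Pmul]; elim: k => [|k IHk]; first by rewrite expr0.
by rewrite exprS => /Pmul[].
Qed.

(** * Krull's principal ideal theorem *)

Definition minimal_over I P :=
  forall J, is_prime J -> sub_ideal I J -> sub_ideal J P -> sub_ideal P J.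

Lemma descending_le (J : nat -> R -> Prop) i k :
  (forall k, sub_ideal (J k.+1) (J k)) -> (i <= k)%N -> sub_ideal (J k) (J i).
Proof.
move=> Jdec /subnK <-; elim: (k - i)%N => // {}k IH x; rewrite addSn => /Jdec.
exact: IH.
Qed.

(* The localization at P of R / I is Artinian: by Noetherian induction on a   *)
(* saturated ideal A below the chain, adjoining to A an element g of its      *)
(* socle, i.e. P g <= A.                                                      *)
Lemma minimal_over_dcc P I : is_prime P -> minimal_over I P ->
  forall A, is_ideal A -> sub_ideal I A -> saturated P A ->
  forall J : nat -> R -> Prop, (forall k, is_ideal (J k)) ->
    (forall k, saturated P (J k)) -> (forall k, sub_ideal A (J k)) ->
    (forall k, sub_ideal (J k.+1) (J k)) ->
  exists k0, forall k, (k0 <= k)%N -> sub_ideal (J k) (J k.+1).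
Proof.
move=> hP minP; apply: noetherian_ind => A hA IHA IA satA J hJ satJ AJ Jdec.
have [A1|A1] := pselect (A 1).
  exists 0%N => k _ x _; rewrite -(mulr1 x); apply: idealM => //; exact: AJ.
(* A maximal colon ideal A : g with g outside A is prime. It contains I, and lies in P because A is
   saturated, so minimality of P forces P into it. *)
have [g Ag PgA] : exists2 g, ~ A g & forall p, P p -> A (p * g).
  have [||K [g [Ag hK]] Kmax] :=
    @noetherian_max (fun K => exists g, ~ A g /\ forall z, K z <-> A (z * g)).
  - move=> K [g [_ hK]]; have -> : K = fun z => A (z * g).
      by apply/funext => z; apply/propext.
    exact: colon_ideal.
  - by exists A, 1; split=> // z; rewrite mulr1.
  exists g => // p Pp; apply/hK; apply: minP Pp => //.
  - split=> [|/hK|x y]; last 1 first.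
    + move=> /hK Axyg; have [Ayg|Ayg] := pselect (A (y * g)); first by right; apply/hK.
      left; apply: (Kmax (fun z => A (z * (y * g)))).
      * by exists (y * g).
      * by move=> z /hK Azg; rewrite mulrCA; apply: idealM.
      by rewrite mulrA.
    + have -> : K = fun z => A (z * g) by apply/funext => z; apply/propext.
      exact: colon_ideal.
    by rewrite mul1r.
  - by move=> z Iz; apply/hK; apply: idealMl => //; apply: IA.
  move=> z /hK Azg; apply: contrapT => Pz; apply: Ag; exact: satA Azg.
have hg := principal_ideal g.
pose add_g B := saturation P (add_ideal B (principal g)).
have add_g_ideal B : is_ideal B -> is_ideal (add_g B).
  by move=> hB; apply: saturation_ideal => //; apply: add_ideal_ideal.
have add_g_sub B : is_ideal B -> sub_ideal B (add_g B).
  by move=> hB x Bx; apply: sub_saturation => //; apply: add_idealL.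
have add_g_mono B D : sub_ideal B D -> sub_ideal (add_g B) (add_g D).
  by move=> BD; apply: saturationS; apply: add_idealS.
have [|||||||||k0 hk0] := IHA (add_g A) _ _ _ _ _ (fun k => add_g (J k)).
- exact: add_g_ideal.
- exact: add_g_sub.
- move=> h; apply/Ag/h; apply: sub_saturation => //.
  by apply: add_idealR => //; apply: principal_id.
- by move=> x /IA; apply: add_g_sub.
- exact: saturation_saturated.
- by move=> k; apply: add_g_ideal.
- by move=> k; apply: saturation_saturated.
- by move=> k; apply: add_g_mono.
- by move=> k; apply: add_g_mono.
have [Jg|/existsNP[k1 Jg]] := pselect (forall k, J k g).
  exists k0 => k k0k x /(add_g_sub _ (hJ k)) /(hk0 _ k0k).
  apply: saturation_sub => //; apply: add_ideal_sub => // _ [r ->].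
  exact: idealM.
exists (maxn k0 k1) => k; rewrite geq_max => /andP[k0k k1k] x Jx.
have {}Jg : ~ J k g by move=> /(descending_le Jdec k1k).
(* In r x = b + t g the coefficient t is in P, as otherwise g would be in J k; hence t g is in A. *)
have [r Pr [b [_ [Jb [t ->] e]]]] := hk0 _ k0k _ (add_g_sub _ (hJ k) _ Jx).
have Jtg : J k (t * g).
  have -> : t * g = r * x - b by rewrite e; ring.
  by apply: idealB => //; [apply: idealM|apply: Jdec].
have Pt : P t by apply: contrapT => Pt; apply: Jg; apply: satJ Jtg.
by apply: (satJ _ _ _ Pr); rewrite e; apply: idealD => //; apply/AJ/PgA.
Qed.

(** Modulo x, the symbolic powers of L stabilize by [minimal_over_dcc]. Nakayama at P turns this
    into equality of two consecutive symbolic powers, and Nakayama at L then puts a power of L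
    inside P0. *)
Lemma principal_ideal_theorem P0 L P x : is_prime P0 -> is_prime L -> is_prime P ->
  sub_ideal P0 L -> sub_ideal L P -> P x -> ~ L x ->
  minimal_over (add_ideal P0 (principal x)) P -> sub_ideal L P0.
Proof.
move=> hP0 hL hP P0L LP Px Lx minP; have iP0 := prime_ideal hP0.
have hx := principal_ideal x.
(* The symbolic powers of L modulo P0. *)
pose S k := saturation L (add_ideal P0 (ideal_pow L k)).
have hS k : is_ideal (S k).
  by apply: saturation_ideal => //; apply: add_ideal_ideal => //; apply: ideal_pow_ideal.
have satS k : saturated L (S k) by apply: saturation_saturated.
have powS k : sub_ideal (ideal_pow L k) (S k).
  by move=> y Ly; apply: sub_saturation => //; apply: add_idealR.
have P0S k : sub_ideal P0 (S k).
  move=> y Ly; apply: sub_saturation => //; apply: add_idealL => //.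
  exact: ideal_pow_ideal.
have Sdec k : sub_ideal (S k.+1) (S k).
  apply: saturationS; apply: add_ideal_sub.
  - by apply: add_ideal_ideal => //; apply: ideal_pow_ideal.
  - by apply: add_idealL; apply: ideal_pow_ideal.
  move=> y /(ideal_pow_le (leqnSn k)); exact: add_idealR.
pose J k := saturation P (add_ideal (S k) (principal x)).
have hadd k : is_ideal (add_ideal (S k) (principal x)) by apply: add_ideal_ideal.
pose A := add_ideal P0 (principal x).
have hA : is_ideal A by apply: add_ideal_ideal.
have [|||||||k0 /(_ k0 (leqnn _)) hJ] :=
  minimal_over_dcc hP minP (A := saturation P A) _ _ _ (J := J).
- exact: saturation_ideal.
- exact: sub_saturation.
- exact: saturation_saturated.
- by move=> k; apply: saturation_ideal.
- by move=> k; apply: saturation_saturated.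
- by move=> k; apply: saturationS; apply: add_idealS.
- by move=> k; apply: saturationS; apply: add_idealS.
have SS : sub_ideal (S k0) (S k0.+1).
  have [s hs] := noethR (hS k0).
  suff h : sub_ideal (span s) (S k0.+1) by move=> y /hs /h.
  apply: (nakayama hP) => //; first exact: saturatedS LP (satS _).
  move=> a /mem_span /hs Sa.
  have [|r Pr [b [_ [Sb [c ->] e]]]] := hJ a.
    by apply: sub_saturation => //; apply: add_idealL.
  exists r => //; exists b, (c * x); split=> //; rewrite mulrC.
  apply: prod_ideal_mem; first exact: Px.
  (* Since x is outside L and S k0 is L-saturated, x c in S k0 gives c in S k0. *)
  apply/hs; apply: (satS _ x) => //; have -> : x * c = r * a - b by rewrite e; ring.
  by apply: idealB => //; [apply: idealM|apply: Sdec].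
(* Locally at L, the inclusion [SS] puts L^k0 inside P0 + L L^k0. *)
have LP0 : sub_ideal (ideal_pow L k0) P0.
  have [s hs] := noethR (ideal_pow_ideal L k0).
  have es : ideal_pow L k0 = span s by apply/funext => y; apply/propext.
  rewrite es; apply: (nakayama hL) => //; first exact: prime_saturated.
  move=> a /mem_span /hs /powS /SS [r Lr hra]; exists r => //.
  by rewrite -es.
move=> y Ly; apply: (@prime_exp _ _ k0) => //; apply: LP0; exact: ideal_pow_exp.
Qed.

(** If P1 misses x and there is no such P, then P2 is minimal over P0 + (x), and the principal ideal
    theorem collapses P1 onto P0. *)
Lemma prime_between P0 P1 P2 x : is_prime P0 -> is_prime P1 -> is_prime P2 ->
  sub_ideal P0 P1 -> ~ sub_ideal P1 P0 -> sub_ideal P1 P2 -> ~ sub_ideal P2 P1 ->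
  P2 x -> ~ P0 x ->
  exists P, [/\ is_prime P, P x, sub_ideal P0 P, sub_ideal P P2 & ~ sub_ideal P2 P].
Proof.
move=> hP0 hP1 hP2 P01 P10 P12 P21 P2x P0x.
have [P1x|P1x] := pselect (P1 x); first by exists P1.
apply: contrapT => h; apply: P10.
apply: (principal_ideal_theorem hP0 hP1 hP2 P01 P12 P2x P1x).
move=> J hJ xJ JP2; apply: contrapT => P2J; apply: h; exists J; split=> //.
  by apply: xJ; apply: add_idealR (principal_id x); apply: prime_ideal.
by move=> z P0z; apply: xJ; apply: add_idealL => //; apply: principal_ideal.
Qed.

(** Noetherian induction on J: with x in N outside J, choose z outside J with x z in J. Both J + (z)
    and J : z are strictly larger than J, and the two exponents found for them add up. *)
Lemma pow_sub_of_nilpotent N J : is_ideal J ->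
  (forall x, N x -> exists k, J (x ^+ k)) -> exists k, sub_ideal (ideal_pow N k) J.
Proof.
move: J; apply: noetherian_ind => J hJ IH nilJ.
have [NJ|/existsNP[x /not_implyP[Nx Jx]]] := pselect (sub_ideal N J).
  exists 1%N => x hx; apply: (ideal_gen_sub hJ _ hx) => _ [a [b [/NJ Ja _ ->]]].
  exact: idealMl.
have [k Jxk] := nilJ x Nx.
have [J1|J1] := pselect (J 1).
  by exists 0%N => y _; rewrite -(mulr1 y); apply: idealM.
have [z Jz Jxz] : exists2 z, ~ J z & J (x * z).
  elim: k Jxk => [|k IHk]; first by rewrite expr0.
  rewrite exprS => Jxxk; have [/IHk//|Jxk] := pselect (J (x ^+ k)).
  by exists (x ^+ k).
have hz := principal_ideal z; have hJz := add_ideal_ideal hJ hz.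
have [|||k1 hk1] := IH _ hJz.
- exact: add_idealL.
- by move=> h; apply/Jz/h; apply: add_idealR => //; apply: principal_id.
- by move=> y /nilJ[i Jyi]; exists i; apply: add_idealL.
have [|||k2 hk2] := IH _ (colon_ideal z hJ).
- by move=> y Jy; apply: idealMl.
- by move=> h; apply/Jx/h.
- by move=> y /nilJ[i Jyi]; exists i; apply: idealMl.
exists (k2 + k1)%N; apply: ideal_pow_add => // u v /hk2 Juz.
move=> /hk1[j [_ [Jj [r ->] ->]]]; rewrite mulrDr; apply: idealD => //.
  exact: idealM.
by rewrite mulrCA; apply: idealM.
Qed.

(** * Local rings and Krull's intersection theorem *)

Record is_local N : Prop := IsLocal {
  local_ideal : is_ideal N;
  local_proper : ~ N 1;
  local_unit : forall x, ~ N x -> exists y, y * x = 1 }.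

Section Local.
Variable N : R -> Prop.
Hypothesis locN : is_local N.
Let hN : is_ideal N := local_ideal locN.

Lemma local_saturated I : is_ideal I -> saturated N I.
Proof.
move=> hI r a /(local_unit locN)[u ur] Ira.
by rewrite -(mul1r a) -ur -mulrA; apply: idealM.
Qed.

Lemma local_prime : is_prime N.
Proof.
split=> //; first exact: local_proper.
move=> x y Nxy; have [Nx|Nx] := pselect (N x); first by left.
by right; apply: (local_saturated _ Nx).
Qed.

Lemma local_nakayama I s : is_ideal I ->
  (forall x, x \in s -> add_ideal I (prod_ideal N (span s)) x) ->
  sub_ideal (span s) I.
Proof.
move=> hI h; apply: (nakayama local_prime) => //; first exact: local_saturated.
by move=> x /h; exists 1; rewrite ?mul1r //; apply: local_proper.
Qed.

Lemma local_proper_sub I : is_ideal I -> ~ I 1 -> sub_ideal I N.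
Proof.
move=> hI I1 x Ix; apply: contrapT => /(local_unit locN)[y yx].
by apply: I1; rewrite -yx; apply: idealM.
Qed.

(** Let M be the intersection of the I + N^k. An ideal J maximal among those that contain I + N M
    and meet M inside it contains a power of N, hence contains M; so M lies in I + N M and Nakayama
    applies. This replaces the Artin-Rees lemma. *)
Lemma krull_intersection I a : is_ideal I ->
  (forall k, add_ideal I (ideal_pow N k) a) -> I a.
Proof.
move=> hI.
pose M x := forall k, add_ideal I (ideal_pow N k) x.
have hIN k : is_ideal (add_ideal I (ideal_pow N k)).
  by apply: add_ideal_ideal => //; apply: ideal_pow_ideal.
have hM : is_ideal M.
  split=> [k|x y Mx My k|r x Mx k]; first exact: ideal0.
    exact: idealD.
  exact: idealM.
pose NM := add_ideal I (prod_ideal N M).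
have hNM : is_ideal NM by apply: add_ideal_ideal => //; apply: prod_ideal_ideal.
have [||J [hJ NMJ JM] Jmax] := @noetherian_max (fun J =>
    [/\ is_ideal J, sub_ideal NM J & forall x, J x -> M x -> NM x]).
- by move=> J [].
- by exists NM; split.
have nilJ x : N x -> exists k, J (x ^+ k).
  move=> Nx.
  have hcol k : is_ideal (fun z => J (z * x ^+ k)) by apply: colon_ideal.
  have [||K [k hK] Kmax] :=
    @noetherian_max (fun K => exists k, K = fun z => J (z * x ^+ k)).
  - by move=> K [k ->].
  - by exists (fun z => J (z * x ^+ 0)), 0%N.
  (* Once the colon ideals J : x^k are stable, J + (x^k) still meets M inside I + N M, so maximality
     of J puts x^k in J. *)
  have colk z : J (z * x ^+ k.+1) -> J (z * x ^+ k).
    move: (Kmax (fun z => J (z * x ^+ k.+1))); rewrite hK; apply.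
      by exists k.+1.
    by move=> y Jy; rewrite exprS mulrCA; apply: idealM.
  have hxk := principal_ideal (x ^+ k).
  exists k; apply: (Jmax (add_ideal J (principal (x ^+ k)))); last first.
  - by apply: add_idealR => //; apply: principal_id.
  - exact: add_idealL.
  split; first exact: add_ideal_ideal.
    by move=> y /NMJ; apply: add_idealL.
  move=> y hy My; apply: JM => //; case: hy My => j [_ [Jj [r ->] ->]] My.
  apply: idealD => //; apply: colk.
  have -> : r * x ^+ k.+1 = x * (j + r * x ^+ k) - x * j by rewrite exprS; ring.
  apply: idealB => //; last exact: idealM.
  apply: NMJ; apply: add_idealR => //; exact: prod_ideal_mem.
have [k NkJ] := pow_sub_of_nilpotent hJ nilJ.
have MNM : sub_ideal M NM.
  move=> x Mx; apply: JM => //; case: (Mx k) => i [p [Ii /NkJ Jp ->]].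
  apply: idealD => //; apply: NMJ; apply: add_idealL => //; exact: prod_ideal_ideal.
have [s hs] := noethR hM.
have es : M = span s by apply/funext => x; apply/propext.
move=> Ma; have : span s a by rewrite -es.
apply: local_nakayama => // x; rewrite -es => xs; apply: MNM.
by rewrite es; apply: mem_span.
Qed.

(** * Chains of primes and systems of generators *)

Inductive prime_chain : nat -> (R -> Prop) -> Prop :=
| PrimeChain0 P : is_prime P -> prime_chain 0 P
| PrimeChainS l P Q : is_prime P -> sub_ideal P Q -> ~ sub_ideal Q P ->
    prime_chain l Q -> prime_chain l.+1 P.

Lemma prime_chain_prime l P : prime_chain l P -> is_prime P.
Proof. by case. Qed.

Lemma prime_chainSP l P : prime_chain l.+1 P ->
  exists Q, [/\ sub_ideal P Q, ~ sub_ideal Q P & prime_chain l Q].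
Proof.
by move=> h; inversion h as [|? ? Q]; exists Q.
Qed.

Lemma prime_sub_local P : is_prime P -> sub_ideal P N.
Proof. by move=> [hP P1 _]; apply: local_proper_sub. Qed.

Lemma prime_chain_proper l P : prime_chain l.+1 P -> ~ sub_ideal N P.
Proof.
move=> /prime_chainSP[Q [_ QP /prime_chain_prime /prime_sub_local QN]] NP.
by apply: QP => x /QN /NP.
Qed.

(** Passing to the quotient by one element lowers the dimension by at most one: [prime_between]
    pushes x down the chain, replacing each prime that misses x, until x lies in the first prime
    above P. *)
Lemma prime_chain_cut l P x : N x -> ~ P x -> prime_chain l.+1 P ->
  exists Q, [/\ Q x, sub_ideal P Q & prime_chain l Q].
Proof.
move=> Nx; elim: l P => [|l IHl] P Px hP.
  exists N; split=> //; last exact/PrimeChain0/local_prime.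
  exact/prime_sub_local/(prime_chain_prime hP).
have [Q [PQ QP hQ]] := prime_chainSP hP; have pP := prime_chain_prime hP.
have [Qx|Qx] := pselect (Q x); first by exists Q.
have [Q2 [Q2x QQ2 hQ2]] := IHl Q Qx hQ.
have [|P' [hP' P'x PP' P'Q2 Q2P']] :=
  prime_between pP (prime_chain_prime hQ) (prime_chain_prime hQ2) PQ QP QQ2 _ Q2x Px.
  by move=> h; apply/Qx/h.
by exists P'; split=> //; apply: PrimeChainS hQ2.
Qed.

Lemma prime_chain_cutW l P x : N x -> prime_chain l.+1 P ->
  exists Q, [/\ Q x, sub_ideal P Q & prime_chain l Q].
Proof.
move=> Nx hP; have [Px|Px] := pselect (P x); last exact: prime_chain_cut.
by have [Q [PQ _ hQ]] := prime_chainSP hP; exists Q; split=> //; apply: PQ.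
Qed.

Definition spans_max s := forall x, N x <-> span s x.

Lemma eq_span s t : s =i t -> forall x, span s x <-> span t x.
Proof. by move=> st x; split; apply: span_mono => y; rewrite st. Qed.

Lemma eq_spans_max s t : s =i t -> spans_max s -> spans_max t.
Proof. by move=> st hs x; rewrite hs; apply: eq_span. Qed.

Lemma spans_max_mem s x : spans_max s -> x \in s -> N x.
Proof. by move=> hs xs; apply/hs/mem_span. Qed.

Lemma span_cons_sub g s I : is_ideal I -> I g -> sub_ideal (span s) I ->
  sub_ideal (span (g :: s)) I.
Proof.
move=> hI Ig sI; apply: span_sub => // x; rewrite inE => /orP[/eqP-> //|xs].
by apply: sI; apply: mem_span.
Qed.

(** The height bound modulo (s): each generator in s' is absorbed at the cost of at most one step of
    the chain. *)
Lemma prime_chain_size l s s' P : spans_max (s' ++ s) -> sub_ideal (span s) P ->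
  prime_chain l P -> (l <= size s')%N.
Proof.
elim: s' l s P => [|x s' IHs'] l s P hs sP; case: l => // l hP.
  by case: (prime_chain_proper hP) => x /hs /sP.
have Nx : N x by apply: spans_max_mem hs _; rewrite mem_head.
have [Q [Qx PQ hQ]] := prime_chain_cutW Nx hP.
apply: (IHs' l (x :: s) Q) => //.
  by apply: eq_spans_max hs => y; rewrite !(inE, mem_cat) orbCA.
apply: span_cons_sub => //; first exact/prime_ideal/(prime_chain_prime hQ).
by move=> y /sP /PQ.
Qed.

Lemma prime_chain_above l s P : (forall x, x \in s -> N x) ->
  prime_chain (size s + l) P -> exists2 Q, sub_ideal (span s) Q & prime_chain l Q.
Proof.
elim: s l => [|x s IHs] l sN hP.
  exists P => // x /span_nil ->.
  exact: (ideal0 (prime_ideal (prime_chain_prime hP))).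
have [||Q sQ hQ] := IHs l.+1.
- by move=> y ys; apply: sN; rewrite inE ys orbT.
- by rewrite addnS.
have [Q' [Q'x QQ' hQ']] := prime_chain_cutW (sN x (mem_head _ _)) hQ.
exists Q' => //; apply: span_cons_sub => //.
  exact/prime_ideal/(prime_chain_prime hQ').
by move=> y /sQ /QQ'.
Qed.

(** Induction on the number of generators left out. A prime Q above (s) with a long enough chain
    misses some x in s'; (x, s) is prime by induction, and Q turns out to equal (s). *)
Lemma span_regular_prime s s' P : spans_max (s' ++ s) ->
  prime_chain (size s + size s') P -> is_prime (span s).
Proof.
have [n] := ubnP (size s'); elim: n s s' => // n IHn s s' le_s' hs hP.
case: s' => [|y s'] in le_s' hs hP *.
  have -> : span s = N by apply/funext => x; apply/propext; rewrite hs.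
  exact: local_prime.
have [|Q sQ hQ] := prime_chain_above _ hP.
  by move=> x xs; apply: spans_max_mem hs _; rewrite mem_cat xs orbT.
have pQ := prime_chain_prime hQ; have [iQ _ Qmul] := pQ.
have [x xs' Qx] : exists2 x, x \in y :: s' & ~ Q x.
  apply: contrapT => h; apply: (prime_chain_proper hQ) => z /hs.
  apply: span_sub => // u; rewrite mem_cat => /orP[us'|us].
    by apply: contrapT => Qu; apply: h; exists u.
  by apply: sQ; apply: mem_span.
have Nx : N x by apply: spans_max_mem hs _; rewrite mem_cat xs'.
have [Q' [Q'x QQ' hQ']] := prime_chain_cut Nx Qx hQ.
have sz : size (rem x (y :: s')) = size s' by rewrite size_rem.
have hs1 : spans_max (rem x (y :: s') ++ x :: s).
  apply: eq_spans_max hs => z; rewrite !mem_cat (perm_mem (perm_to_rem xs')).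
  by rewrite !inE orbCA orbA.
have pJ : is_prime (span (x :: s)).
  apply: (IHn _ (rem x (y :: s'))) => //; first by rewrite sz.
  by move: hP; rewrite /= sz addnS addSn.
have JQ' : sub_ideal (span (x :: s)) Q'.
  apply: span_cons_sub => //; last by move=> z /sQ /QQ'.
  exact/prime_ideal/(prime_chain_prime hQ').
(* A strict inclusion would give a chain above (x, s) longer than the number of remaining
   generators. *)
have Q'J : sub_ideal Q' (span (x :: s)).
  apply: contrapT => h.
  have hJ : prime_chain (size s').+1 (span (x :: s)) by apply: PrimeChainS hQ'.
  by have := prime_chain_size hs1 (fun z h => h) hJ; rewrite sz ltnn.
(* For a = r x + b in Q, primality gives r in Q since x is not; thus Q lies in (s) + x Q, and
   Nakayama applies. *)
have Qs : sub_ideal Q (span s).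
  have [q hq] := noethR iQ.
  have eq : Q = span q by apply/funext => z; apply/propext.
  rewrite {1}eq; apply: local_nakayama; first exact: span_ideal.
  rewrite -eq => a /mem_span /hq Qa.
  have /span_cons[r [b [sb e]]] := Q'J _ (QQ' _ Qa).
  have Qr : Q r.
    suff : Q (r * x) by case/Qmul.
    by apply: (idealBr iQ) (sQ _ sb); rewrite -e.
  exists b, (x * r); split=> //; first exact: prod_ideal_mem.
  by rewrite e; ring.
suff -> : span s = Q by [].
by apply/funext => z; apply/propext; split=> [/sQ|/Qs].
Qed.

(** * Regular local rings: generators adapted to f *)

Section Regular.
Variable D : nat.
Hypothesis chainD : exists P, prime_chain D P.
Hypothesis minD : forall s, spans_max s -> (D <= size s)%N.

Lemma span_prime s s' : spans_max (s' ++ s) -> (size s' + size s = D)%N ->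
  is_prime (span s).
Proof.
by move=> hs sz; have [P hP] := chainD; apply: (@span_regular_prime s s' P);
  rewrite // addnC sz.
Qed.

Lemma spans_max_rem g s : spans_max (g :: s) -> span s g -> spans_max s.
Proof.
move=> hs sg x; rewrite hs; split; first by apply: span_cons_sub; first exact: span_ideal.
by apply: span_mono => y ys; rewrite inE ys orbT.
Qed.

Lemma spans_max_minimal g s : spans_max (g :: s) -> (size s).+1 = D -> ~ span s g.
Proof.
by move=> hs sz sg; have := minD (spans_max_rem hs sg); rewrite -sz ltnn.
Qed.

(** Steinitz exchange in N/N^2. If no z in t has a unit coefficient on h modulo the other
    generators, then h lies in their span plus N h, so Nakayama makes h redundant, against
    minimality. *)
Lemma exchange_generators g t : spans_max g -> size g = D -> spans_max t ->
  exists s, [/\ spans_max s, size s = D & {subset s <= t}].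
Proof.
move=> hg sg ht.
suff h k : (k <= D)%N -> exists s s',
    [/\ spans_max (s' ++ s), {subset s <= t}, size s = k & (size s' + k = D)%N].
  have [s [s' [hs st sk /eqP]]] := h D (leqnn D).
  by rewrite -{2}[D]add0n eqn_add2r size_eq0 => /eqP e; move: hs; rewrite e; exists s.
elim: k => [|k IHk] kD; first by exists [::], g; rewrite cats0 addn0.
have [s [[|h s'] [hs st sk sz]]] := IHk (ltnW kD).
  by move: kD; rewrite -sz ltnn.
have hh := span_ideal (s' ++ s).
have [[z [r [zt Nr szr]]]|nz] := pselect (exists z r,
    [/\ z \in t, ~ N r & span (s' ++ s) (z - r * h)]).
  exists (z :: s), s'; split; last 2 first.
  - by rewrite /= sk.
  - by rewrite addnS.
  - have hz := span_ideal (s' ++ z :: s).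
    move=> x; split; last first.
      apply: span_sub; first exact: local_ideal.
      move=> y; rewrite mem_cat inE orbCA => /orP[/eqP->|ys].
        exact: spans_max_mem ht zt.
      by apply: spans_max_mem hs _; rewrite inE mem_cat ys orbT.
    move/hs; apply: span_cons_sub => //; last first.
      by apply: span_mono => y; rewrite !mem_cat inE => /orP[->//|->]; rewrite !orbT.
    have [u ur] := local_unit locN Nr.
    have -> : h = u * (z - (z - r * h)) by rewrite -[LHS]mul1r -ur; ring.
    apply/(idealM hz)/(idealB hz).
      by apply: mem_span; rewrite mem_cat mem_head orbT.
    by apply: span_mono szr => y; rewrite !mem_cat inE => /orP[->//|->]; rewrite !orbT.
  by move=> y; rewrite inE => /orP[/eqP->|/st].
case: (@spans_max_minimal h (s' ++ s)) => //.
  by rewrite size_cat sk -sz.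
suff : sub_ideal (span [:: h]) (span (s' ++ s)) by apply; apply/mem_span/mem_head.
apply: local_nakayama => // x; rewrite inE => /eqP->.
have : span t h by apply/ht/hs/mem_span/mem_head.
apply: span_sub; first by apply: add_ideal_ideal => //; apply: prod_ideal_ideal.
move=> z zt; have /span_cons[r [b [sb e]]] : span (h :: s' ++ s) z.
  exact/hs/(spans_max_mem ht).
exists b, (r * h); split=> //; last by rewrite e addrC.
apply: prod_ideal_mem; last exact/mem_span/mem_head.
apply: contrapT => Nr; apply: nz; exists z, r; split=> //.
by rewrite e addrC addKr.
Qed.

Lemma prime_prod P k (F : 'I_k -> R) : is_prime P -> P (\prod_i F i) ->
  exists i, P (F i).
Proof.
move=> [_ P1 Pmul]; elim: k F => [|k IHk] F; first by rewrite big_ord0.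
by rewrite big_ord_recr /= => /Pmul[/IHk[i Pi]|Pk]; eexists; [apply: Pi|apply: Pk].
Qed.

Lemma ideal_pow_prod I k (F : 'I_k -> R) : (forall i, I (F i)) ->
  ideal_pow I k (\prod_i F i).
Proof.
elim: k F => [//|k IHk] F IF; rewrite big_ord_recr /= mulrC.
by apply: ideal_powS => //; apply: IHk.
Qed.

(* Nagata's trick: the primes P_j = (s, u - v^j) are pairwise incomparable,   *)
(* so if f lay in all of them it would lie in (s) + N^k for every k.          *)
Lemma avoid_step f u v s s' : spans_max (u :: v :: s' ++ s) ->
  (size s' + size s).+2 = D -> ~ span s f ->
  exists j, spans_max ((v :: s') ++ (u - v ^+ j) :: s) /\
    ~ span ((u - v ^+ j) :: s) f.
Proof.
(* The exponent starts at 1, so that v^(j+1) is a multiple of v and v, w j recover u. *)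
move=> hs sz sf; pose w j := u - v ^+ j.+1.
have hw j : spans_max ((v :: s') ++ w j :: s).
  have hx := span_ideal ((v :: s') ++ w j :: s).
  have hv : span ((v :: s') ++ w j :: s) v by apply/mem_span/mem_head.
  have Nv : N v by apply: spans_max_mem hs _; rewrite !inE eqxx orbT.
  have Nu : N u by apply: spans_max_mem hs _; rewrite !inE eqxx.
  move=> x; split.
    move/hs; apply: span_cons_sub => //.
      rewrite -(subrK (v ^+ j.+1) u); apply: idealD => //.
        by apply: mem_span; rewrite mem_cat mem_head orbT.
      by rewrite exprSr; apply: idealM.
    by apply: span_mono => y; rewrite /= !inE !mem_cat !inE => /or3P[->|->|->];
      rewrite ?orbT.
  apply: span_sub; first exact: local_ideal.
  move=> y; rewrite mem_cat inE orbCA => /orP[/eqP->|ys].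
    by rewrite /w exprSr; apply: idealB => //; apply: idealM.
  by apply: spans_max_mem hs _; rewrite inE -cat_cons mem_cat ys orbT.
apply: contrapT => h.
have {h} wf j : span (w j :: s) f.
  by apply: contrapT => hf; apply: h; exists j.+1; split=> //; apply: hw.
have pw j : is_prime (span (w j :: s)).
  by apply: span_prime (hw j) _; rewrite /= addSn addnS.
have Nw j : N (w j) by apply: spans_max_mem (hw j) _; rewrite mem_cat mem_head orbT.
have hS := span_ideal s.
have sw j : sub_ideal (span s) (span (w j :: s)).
  by apply: span_mono => y ys; rewrite inE ys orbT.
(* The difference of w j and w i is v^(i+1) (1 - v^(j-i)). Its second factor is a unit, so w i in
   P_j would put v in P_j, against minimality of the generators. *)
have wn i j : (i < j)%N -> ~ span (w j :: s) (w i).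
  move=> ij wi; have [iP P1 Pmul] := pw j.
  have : span (w j :: s) (v ^+ i.+1 * (1 - v ^+ (j - i))).
    have -> : v ^+ i.+1 * (1 - v ^+ (j - i)) = w j - w i.
      by rewrite /w mulrBr -exprD addSn subnKC ?(ltnW ij) //; ring.
    by apply: idealB => //; apply/mem_span/mem_head.
  have Nv : N v by apply: spans_max_mem hs _; rewrite !inE eqxx orbT.
  case/Pmul => [/(prime_exp (pw j)) hv|/(prime_sub_local (pw j)) h1].
    apply: (@spans_max_minimal v (s' ++ w j :: s)) => //.
    - exact: hw.
    - by rewrite size_cat /= addnS.
    by apply: span_mono hv => y; rewrite mem_cat => ->; rewrite orbT.
  apply: (local_proper locN); rewrite -(subrK (v ^+ (j - i)) 1).
  apply: (idealD hN) => //; have -> : (j - i = (j - i).-1.+1)%N.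
    by rewrite prednK // subn_gt0.
  by rewrite exprSr; apply: idealM.
apply: sf; apply: krull_intersection => // k.
(* Factors are split off one by one: P_k contains f but no w i with i < k, so the cofactor g lies in
   P_k, that is, in (w k) + (s). *)
have [g sg] : exists g, span s (f - (\prod_(i < k) w i) * g).
  elim: k => [|k [g sg]].
    by exists f; rewrite big_ord0 mul1r subrr; apply: ideal0.
  have [iP P1 Pmul] := pw k.
  have : span (w k :: s) ((\prod_(i < k) w i) * g).
    rewrite -[X in span _ X](subKr f); apply: idealB => //.
    exact: sw.
  case/Pmul => [/(prime_prod (pw k))[i wi]|]; first by case: (wn i k).
  move=> /span_cons[r [b [sb e]]]; exists r; rewrite big_ord_recr /=.
  have -> : f - \prod_(i < k) w i * w k * r =
      f - \prod_(i < k) w i * g + \prod_(i < k) w i * b by rewrite e; ring.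
  by apply: idealD => //; apply: idealM.
exists (f - \prod_(i < k) w i * g), (\prod_(i < k) w i * g); split=> //.
  by apply: idealMl; [apply: ideal_pow_ideal|apply: ideal_pow_prod].
by rewrite subrK.
Qed.

(** G will be the set of elements liftable from A; its closure under x - y^j is what [avoid_step]
    needs, applied D - 1 times from the empty list. *)
Lemma avoid_generators (G : R -> Prop) f t :
  (forall x y j, G x -> G y -> G (x - y ^+ j)) ->
  spans_max t -> size t = D -> (forall x, x \in t -> G x) -> f <> 0 -> (0 < D)%N ->
  exists s T, [/\ spans_max (T :: s), (size s).+1 = D,
    forall x, x \in T :: s -> G x & ~ span s f].
Proof.
move=> hG ht st tG f0 D0.
suff h k : (k < D)%N -> exists s s',
    [/\ spans_max (s' ++ s), size s = k, (size s' + k = D)%N,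
      forall x, x \in s' ++ s -> G x & ~ span s f].
  have [|s [[|T [|? s']] [hs sk sD sG sf]]] := h D.-1; first by rewrite prednK.
  - by move: D0 sD => /=; lia.
  - by exists s, T; split=> //; rewrite sk prednK.
  - by move: D0 sD => /=; lia.
elim: k => [|k IHk] kD.
  exists [::], t; rewrite cats0 addn0; split=> // /span_nil.
  exact: f0.
have [s [[|u [|v s']] [hs sk sD sG sf]]] := IHk (ltnW kD).
- by move: kD sD => /=; lia.
- by move: kD sD => /=; lia.
have [|j [hw wf]] := avoid_step hs _ sf; first by rewrite sk -sD.
exists ((u - v ^+ j) :: s), (v :: s'); split=> //.
- by rewrite /= sk.
- by rewrite addnS -sD.
move=> x; rewrite mem_cat inE orbCA => /orP[/eqP->|hx].
  by apply: hG; apply: sG; rewrite !inE eqxx ?orbT.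
by apply: sG; rewrite inE -cat_cons mem_cat hx orbT.
Qed.

(** Modulo s, f is a unit times a power of T: take the last power of T dividing f, which exists by
    Krull's intersection theorem; a cofactor in N = (T, s) would allow one more T. *)
Lemma power_in_span f s T : spans_max (T :: s) -> ~ span s f ->
  exists k, add_ideal (span s) (principal f) (T ^+ k).
Proof.
move=> hs sf; have hS := span_ideal s.
have /existsNP[k0 hk0] : ~ forall k, add_ideal (span s) (principal (T ^+ k)) f.
  move=> h; apply: sf; apply: krull_intersection => // k.
  case: (h k) => b [_ [sb [r ->] ->]]; exists b, (r * T ^+ k); split=> //.
  apply: idealM; first exact: ideal_pow_ideal.
  by apply: ideal_pow_exp; apply: spans_max_mem hs (mem_head _ _).
have ex : exists k, `[< ~ add_ideal (span s) (principal (T ^+ k)) f >].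
  by exists k0; apply/asboolP.
case: (ex_minnP ex) => -[|k] /asboolP hk kmin.
  by case: hk; apply: add_idealR => //; exists f; rewrite mulr1.
have : add_ideal (span s) (principal (T ^+ k)) f.
  apply: contrapT => h; have /kmin : `[< ~ add_ideal (span s) (principal (T ^+ k)) f >].
    exact/asboolP.
  by rewrite ltnn.
case=> b [_ [sb [r ->] e]].
have /(local_unit locN)[u ur] : ~ N r.
  move=> /hs /span_cons[c [d [sd e']]]; apply: hk.
  exists (b + T ^+ k * d), (c * T ^+ k.+1); split; last by rewrite e e' exprS; ring.
    by apply: idealD => //; apply: idealM.
  by exists c.
exists k, (- u * b), (u * f); split; [exact: idealM|by exists u|].
by rewrite e -[LHS]mul1r -ur; ring.
Qed.

(** The sequence is read from the tail of the list: w must be regular modulo f and the elements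
    listed after it. *)
Definition regular_mod f s := forall s1 w s2, s = s1 ++ w :: s2 ->
  forall r, add_ideal (span s2) (principal f) (w * r) ->
  add_ideal (span s2) (principal f) r.

(** Let w r = b + c f. As (w, s2) is prime and misses f, c = c' w + p with p in (s2); then w (r - c'
    f) is in the prime (s2), which misses w. For f = 0 the primality of (s2) is enough. *)
Lemma regular_mod_generators f s s' : spans_max (s' ++ s) ->
  (size s' + size s = D)%N -> ~ span s f \/ f = 0 -> regular_mod f s.
Proof.
move=> hs sD hf s1 w s2 es; rewrite es in hs sD hf.
have hs2 : spans_max (w :: (s' ++ s1) ++ s2).
  apply: eq_spans_max hs => x; rewrite !(inE, mem_cat).
  by case: (x == w); rewrite ?orbT ?orbA.
have hS2 := span_ideal s2.
have p2 : is_prime (span s2).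
  apply: (@span_prime s2 (s' ++ s1 ++ [:: w])); first by rewrite -!catA.
  by rewrite -sD !size_cat /=; lia.
have w2 : ~ span s2 w.
  move=> h; apply: (spans_max_minimal hs2); first by rewrite -sD !size_cat /=; lia.
  by apply: span_mono h => x; rewrite mem_cat => ->; rewrite orbT.
move=> r; case: hf => [sf|->]; last first.
  case=> b [_ [sb [c ->] e]]; apply: add_idealL; first exact: principal_ideal.
  have : span s2 (w * r) by rewrite e mulr0 addr0.
  by case/(prime_mul p2).
have pw : is_prime (span (w :: s2)).
  apply: (@span_prime (w :: s2) (s' ++ s1)); first by rewrite -!catA.
  by rewrite -sD !size_cat; lia.
have wf : ~ span (w :: s2) f.
  by move=> h; apply: sf; apply: span_mono h => x; rewrite mem_cat => ->; rewrite orbT.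
case=> b [_ [sb [c ->] e]].
have : span (w :: s2) (c * f).
  have -> : c * f = r * w + (- 1) * b by rewrite (mulrC r) e; ring.
  by apply/span_cons; exists r, (- 1 * b); split=> //; apply: idealM.
case/(prime_mul pw) => // /span_cons[c' [p [sp ec]]].
have : span s2 (w * (r - c' * f)).
  have -> : w * (r - c' * f) = b + f * p.
    by rewrite mulrBr e ec; ring.
  by apply: idealD => //; apply: idealM.
case/(prime_mul p2) => // h; exists (r - c' * f), (c' * f).
by split=> //; [exists c'|rewrite subrK].
Qed.

Lemma regular_system (G : R -> Prop) f g t : spans_max g -> size g = D ->
  N f -> G 0 -> (forall x y j, G x -> G y -> G (x - y ^+ j)) ->
  spans_max t -> (forall x, x \in t -> G x) ->
  exists s T k, [/\ forall x, x \in T :: s -> G x /\ N x,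
    sub_ideal N (span (T :: s)), add_ideal (span s) (principal f) (T ^+ k)
    & regular_mod f s].
Proof.
move=> hg sg Nf G0 hG ht tG.
have [t' [ht' st' t't]] := exchange_generators hg sg ht.
have t'G x : x \in t' -> G x by move=> /t't /tG.
have [f0|f0] := eqVneq f 0.
  (* For f = 0 the whole minimal system is the sequence, and T = 0 has its first power in every
     ideal. *)
  exists t', 0, 1%N; split.
  - move=> x; rewrite inE => /orP[/eqP->|xt']; first by split=> //; apply: ideal0.
    by split; [apply: t'G|apply: spans_max_mem xt'].
  - by move=> x /ht'; apply: span_mono => y yt; rewrite inE yt orbT.
  - by apply: ideal0; apply: add_ideal_ideal; [apply: span_ideal|apply: principal_ideal].
  by apply: (@regular_mod_generators _ _ [::]) => //; right.
have D0 : (0 < D)%N.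
  rewrite lt0n; apply/eqP => D0; move: f0; rewrite (span_nil (x := f)) ?eqxx //.
  by rewrite -(size0nil (etrans sg D0)); apply/hg.
have [s [T [hs sD sG sf]]] :=
  avoid_generators hG ht' st' t'G (elimN eqP f0) D0.
have [k hk] := power_in_span hs sf.
exists s, T, k; split=> //.
- by move=> x xs; split; [apply: sG|apply: spans_max_mem xs].
- by move=> x /hs.
by apply: (@regular_mod_generators _ _ [:: T]) => //; left.
Qed.

End Regular.
End Local.
End Ideals.

Local Notation mem_ideal m := (fun x => x \in m).

(** * Translation of the given notions of local ring and dimension *)

Lemma local_ring_noetherian (R : comNzRingType) (m : idealr R) :
  local_ring m -> is_noetherian R.
Proof. by case=> /noetherianW. Qed.

(** A non-unit lies in a maximal proper ideal, which exists by the Noetherian property and can only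
    be m. *)
Lemma local_ring_is_local (R : comNzRingType) (m : idealr R) :
  local_ring m -> is_local (mem_ideal m).
Proof.
move=> locR; have noethR := local_ring_noetherian locR; case: locR => _ _ maxm.
split; [exact: idealr_is_ideal|by rewrite idealr1|move=> x xm].
apply: contrapT => nx; have hx := principal_ideal x.
have [||J [hJ J1 xJ] Jmax] := @noetherian_max _ noethR
  (fun K => [/\ is_ideal K, ~ K 1 & sub_ideal (principal x) K]).
- by move=> K [].
- by exists (principal x); split=> // -[r e]; apply: nx; exists r.
have [J' hJ'] := is_ideal_idealr hJ J1; apply: xm.
rewrite -(maxm J'); first exact/hJ'/xJ/principal_id.
move=> K JK z Kz; apply/hJ'; apply: (Jmax (mem_ideal K)) Kz.
  split; [exact: idealr_is_ideal|by rewrite idealr1|].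
  by move=> u /xJ /hJ' /JK.
by move=> u /hJ' /JK.
Qed.

Lemma idealr_closed_prime (R : comNzRingType) (S : {pred R}) :
  idealr_closed S -> prime_idealr_closed S -> is_prime (mem_ideal S).
Proof.
move=> [S0 S1 SD] Smul; split; last by move=> x y /Smul /orP.
  split=> // [x y Sx Sy|a x Sx]; first by rewrite -(mul1r x); apply: SD.
  by rewrite -[a * x]addr0; apply: SD.
exact/negP.
Qed.

Lemma krull_dim_prime_chain (R : comNzRingType) d :
  krull_dim R d -> exists P : R -> Prop, prime_chain d P.
Proof.
move=> [[c [cP cS]] _].
have hc i : (i <= d)%N -> is_prime (mem_ideal (c i)).
  by move=> /cP[h1 h2]; apply: idealr_closed_prime.
suff h l i : (i + l = d)%N -> prime_chain l (mem_ideal (c i)).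
  by exists (mem_ideal (c 0%N)); apply: h.
elim: l i => [|l IHl] i e; first by apply/PrimeChain0/hc; rewrite -e leq_addr.
have id : (i < d)%N by rewrite -e addnS ltnS leq_addr.
have [ci nci] := cS i id.
apply: (@PrimeChainS _ _ _ (mem_ideal (c i.+1))) => //; first exact/hc/ltnW.
by apply: IHl; rewrite -e addnS.
Qed.

(** * The completion: units and generators of its maximal ideal *)

Section CompletionTheory.
Variables (A : comNzRingType) (m : idealr A).
Hypothesis locA : is_local (mem_ideal m).
Local Notation M := (mem_ideal m).
Local Notation Ahat := (completion m).
Local Notation iota := (to_completion m).
Local Notation quo n := (@to_quot_exp A m n).

Lemma to_completionB a b : iota (a - b) = iota a - iota b.
Proof. by apply/completionP => n /=; rewrite rmorphB. Qed.

Lemma to_completionD a b : iota (a + b) = iota a + iota b.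
Proof. by apply/completionP => n /=; rewrite rmorphD. Qed.

Lemma to_completionM a b : iota (a * b) = iota a * iota b.
Proof. by apply/completionP => n /=; rewrite rmorphM. Qed.

Lemma to_completion0 : iota 0 = 0.
Proof. by apply/completionP => n /=; rewrite rmorph0. Qed.

Lemma to_completion1 : iota 1 = 1.
Proof. by apply/completionP => n /=; rewrite rmorph1. Qed.

Lemma to_completionX a k : iota (a ^+ k) = iota a ^+ k.
Proof.
elim: k => [|k IHk]; first by rewrite !expr0 to_completion1.
by rewrite !exprS to_completionM IHk.
Qed.

Lemma coord_sum k (F : 'I_k -> Ahat) n : (\sum_i F i) n = \sum_i F i n.
Proof. by elim/big_rec2: _ => // i x y _ <-. Qed.

Lemma quoP n a b : (quo n a = quo n b) <-> ideal_pow M n.+1 (a - b).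
Proof. by rewrite to_quot_exp_eq ideal_expP. Qed.

Lemma ideal_pow1 a : ideal_pow M 1 a <-> M a.
Proof.
have hM := idealr_is_ideal m.
split=> [h|am]; last by rewrite -(mulr1 a); apply: prod_ideal_mem.
by apply: (ideal_gen_sub hM _ h) => _ [x [y [xm _ ->]]]; exact: (idealMl y hM).
Qed.

Lemma coord0_repr (x : Ahat) n a : x n = quo n a -> x 0%N = quo 0 a.
Proof.
elim: n => // n IHn e; apply: IHn.
by rewrite -coord_coherent e transitionE.
Qed.

Lemma completion_unit (x : Ahat) : x 0%N <> 0 -> exists y, y * x = 1.
Proof.
move=> x0; have inv n : exists y, y * x n = 1.
  have [a ea] := to_quot_exp_surj (x n).
  have [|b ba] := local_unit locA (x := a).
    move=> am; apply: x0; rewrite (coord0_repr ea) -(rmorph0 (quo 0)).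
    by apply/quoP; rewrite subr0; apply/ideal_pow1.
  by exists (quo n b); rewrite ea -rmorphM ba rmorph1.
pose y n := sval (cid (inv n)).
have hy n : y n * x n = 1 := svalP (cid (inv n)).
(* Inverses are unique, so inverses chosen coordinate by coordinate are coherent. *)
have coh n : transition (y n.+1) = y n.
  rewrite -[LHS]mulr1 -(hy n) mulrCA -(coord_coherent x) -rmorphM hy rmorph1.
  by rewrite mulr1.
by exists (Completion coh); apply/completionP => n; apply: hy.
Qed.

Lemma ideal_powS_sum k (g : 'I_k -> A) n z : generates m g ->
  ideal_pow M n.+1 z ->
  exists c : 'I_k -> A, (forall i, ideal_pow M n (c i)) /\ z = \sum_i g i * c i.
Proof.
move=> hg; have hn := ideal_pow_ideal M n.
have hI : is_ideal (fun z => exists c : 'I_k -> A,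
    (forall i, ideal_pow M n (c i)) /\ z = \sum_i g i * c i).
  split.
  - exists (fun=> 0); split=> [i|]; first exact: ideal0.
    by rewrite big1 // => i _; rewrite mulr0.
  - move=> _ _ [c [hc ->]] [d [hd ->]]; exists (fun i => c i + d i).
    split=> [i|]; first exact: idealD.
    by rewrite -big_split; apply: eq_bigr => i _; rewrite mulrDr.
  - move=> a _ [c [hc ->]]; exists (fun i => a * c i).
    split=> [i|]; first exact: idealM.
    by rewrite mulr_sumr; apply: eq_bigr => i _; rewrite mulrCA.
move=> hz; apply: (ideal_gen_sub hI _ hz) => _ [a [b [/hg[e ->] hb ->]]].
exists (fun i => e i * b); split=> [i|]; first exact: idealM.
by rewrite mulr_suml; apply: eq_bigr => i _; ring.
Qed.

(* An element of the kernel of the projection to A / m is represented by a    *)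
(* Cauchy sequence b of A whose increments are expanded on the generators g,  *)
(* the coefficients being summed into elements of the completion.             *)
Lemma coord0_generates k (g : 'I_k -> A) (x : Ahat) : generates m g ->
  x 0%N = 0 -> exists c : 'I_k -> Ahat, x = \sum_i iota (g i) * c i.
Proof.
move=> hg x0; have [b hb] := choice (fun n => to_quot_exp_surj (x n)).
pose e n := if n is n'.+1 then b n - b n' else b 0%N.
have coh n : quo n (b n.+1) = quo n (b n).
  by rewrite -hb -coord_coherent hb transitionE.
have he n : exists c : 'I_k -> A,
    (forall i, ideal_pow M n.-1 (c i)) /\ e n = \sum_i g i * c i.
  case: n => [|n]; last exact/(ideal_powS_sum hg)/quoP.
  apply: (@ideal_powS_sum _ g 0) => //.
  by rewrite -[e 0%N]subr0; apply/quoP; rewrite -hb x0 rmorph0.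
have [c hc] := choice he.
pose C n i := \sum_(j < n.+1) c j i.
have bC n : b n = \sum_i g i * C n i.
  elim: n => [|n IHn].
    rewrite -[b 0%N]/(e 0%N) (hc 0%N).2; apply: eq_bigr => i _.
    by rewrite /C big_ord1.
  rewrite -(subrK (b n) (b n.+1)) -[_ - _]/(e n.+1) (hc n.+1).2 IHn -big_split.
  by apply: eq_bigr => i _; rewrite /C [in RHS]big_ord_recr /= mulrDr addrC.
(* The coefficients c j lie only in m^(j-1), so coordinate n, taken modulo m^(n+1), needs the
   partial sum up to n + 1. *)
have Ccoh i n : transition (quo n.+1 (C n.+2 i)) = quo n (C n.+1 i).
  rewrite transitionE; apply/quoP.
  by rewrite /C [X in X - _]big_ord_recr /= addrAC subrr add0r; apply: (hc n.+2).1.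
exists (fun i => Completion (Ccoh i)); apply/completionP => n.
rewrite coord_sum hb -coh bC rmorph_sum; apply: eq_bigr => i _ /=.
by rewrite rmorphM.
Qed.

End CompletionTheory.

(** * Transfer between A and Q through Q/(f) *)

Section HypersurfaceLift.
Variables (A : comNzRingType) (m : idealr A).
Variables (Q : comNzRingType) (n : idealr Q) (f : Q) (I : idealr Q).
Variable phi : {rmorphism completion m -> {ideal_quot I}}.
Hypotheses (noethA : is_noetherian A) (locA : is_local (mem_ideal m)).
Hypotheses (locQ : is_local (mem_ideal n)) (nf : f \in n).
Hypothesis hI : forall x, x \in I <-> principal f x.
Hypothesis bij_phi : bijective phi.
Local Notation iota := (to_completion m).
Local Notation pi := (\pi_({ideal_quot I})%qT : Q -> {ideal_quot I}).

(** A relation, since an element of A determines q only modulo f; it respects the ring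
    operations. *)
Definition lifts a q := phi (iota a) = pi q.

Lemma pi_eq x y : pi x = pi y <-> principal f (x - y).
Proof.
rewrite -hI (Quotient.idealrBE I); split=> [->|/eqP//]; exact: eqxx.
Qed.

Lemma pi_surj (x : {ideal_quot I}) : exists q, x = pi q.
Proof. by exists (repr x); rewrite reprK. Qed.

Lemma lifts_total a : exists q, lifts a q.
Proof. exact: pi_surj. Qed.

Lemma liftsD a b q r : lifts a q -> lifts b r -> lifts (a + b) (q + r).
Proof. by rewrite /lifts to_completionD !rmorphD => -> ->. Qed.

Lemma liftsB a b q r : lifts a q -> lifts b r -> lifts (a - b) (q - r).
Proof. by rewrite /lifts to_completionB !rmorphB => -> ->. Qed.

Lemma liftsM a b q r : lifts a q -> lifts b r -> lifts (a * b) (q * r).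
Proof. by rewrite /lifts to_completionM !rmorphM => -> ->. Qed.

Lemma liftsX a q k : lifts a q -> lifts (a ^+ k) (q ^+ k).
Proof. by rewrite /lifts to_completionX !rmorphXn => ->. Qed.

Lemma lifts0 : lifts 0 0.
Proof. by rewrite /lifts to_completion0 !rmorph0. Qed.

Lemma lifts_uniq a q r : lifts a q -> lifts a r -> principal f (q - r).
Proof. by rewrite /lifts => -> /pi_eq. Qed.

Lemma phi_surj q : exists x, phi x = pi q.
Proof. by case: bij_phi => g _ gK; exists (g (pi q)). Qed.

Lemma principal_max q : principal f q -> q \in n.
Proof. by move=> [r ->]; apply: idealMr. Qed.

Lemma pi_nonunit q x : q \in n -> x * pi q <> 1.
Proof.
move=> qn; have [r ->] := pi_surj x.
rewrite -rmorphM -(rmorph1 pi) => /pi_eq /principal_max h.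
have := idealr1 n; rewrite -[1](subKr (r * q)) rpredB //.
exact: idealMr.
Qed.

Lemma lifts_max a q : lifts a q -> (a \in m) = (q \in n).
Proof.
move=> aq; apply/idP/idP => [am|qn]; apply: contraT => /negP.
  move=> /(local_unit locQ)[u uq]; have [y hy] := phi_surj u.
  have /(bij_inj bij_phi) e : phi (y * iota a) = phi 1.
    by rewrite rmorphM hy aq -rmorphM uq !rmorph1.
  have /eqP := congr1 (fun x : completion m => x 0%N) e.
  suff -> : (y * iota a) 0%N = 0 by rewrite eq_sym oner_eq0.
  rewrite /= (_ : to_quot_exp m 0 a = 0) ?mulr0 //.
  by rewrite -(rmorph0 (to_quot_exp m 0)); apply/quoP; rewrite subr0; apply/ideal_pow1.
move=> /(local_unit locA)[b ba].
case: (@pi_nonunit q (phi (iota b)) qn).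
by rewrite -aq -rmorphM -to_completionM ba to_completion1 rmorph1.
Qed.

(** Take f, which lifts 0, together with lifts of generators of m: by [coord0_generates] the latter
    generate modulo f. *)
Lemma lifts_generate : exists t : seq Q,
  spans_max (mem_ideal n) t /\ forall x, x \in t -> exists a, lifts a x.
Proof.
have [s hs] := noethA (idealr_is_ideal m); have hg := span_generates hs.
set g := (fun i : 'I_(size s) => s`_i) in hg.
have [z hz] := choice (fun i => lifts_total (g i)).
have zn i : z i \in n.
  rewrite -(lifts_max (hz i)); apply/hs; exact/mem_span/mem_nth.
exists (f :: codom z); split; last first.
  move=> x; rewrite inE => /orP[/eqP->|/codomP[i ->]]; last by exists (g i).
  exists 0; rewrite /lifts to_completion0 rmorph0 -(rmorph0 pi); apply/pi_eq.
  by exists (- 1); rewrite sub0r mulN1r.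
move=> q; split; last first.
  move=> hq; apply: (span_sub (idealr_is_ideal n) _ hq).
  by move=> x; rewrite inE => /orP[/eqP-> //|/codomP[i ->]].
move=> qn; have [x hx] := phi_surj q.
have [|c ec] := coord0_generates hg (x := x).
  apply: contrapT => /(completion_unit locA)[y yx].
  by apply: (@pi_nonunit q (phi y) qn); rewrite -hx -rmorphM yx rmorph1.
have [w hw] := choice (fun i => pi_surj (phi (c i))).
have : pi q = pi (\sum_i w i * z i).
  rewrite -hx ec !rmorph_sum; apply: eq_bigr => i _.
  by rewrite !rmorphM hz hw mulrC.
move=> /pi_eq[r er]; apply/span_cons; exists r, (\sum_i w i * z i).
split; last by rewrite -er subrK.
by apply/span_codom; exists w.
Qed.

Section Descent.
Variables (alpha : Q -> A) (s : seq Q).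
Hypothesis lifts_s : forall x, x \in s -> lifts (alpha x) x.

(** An ideal of A is the contraction of its extension to the completion, because it is closed in the
    m-adic topology ([krull_intersection]). *)
Lemma lifts_descend a q : lifts a q ->
  add_ideal (span s) (principal f) q -> span (map alpha s) a.
Proof.
move=> aq hq; have hS := span_ideal (map alpha s).
(* J consists of the q whose class comes from the closure of (alpha s) in the completion; it is an
   ideal containing s and f. *)
pose J q := exists2 x, phi x = pi q &
  forall k, exists2 b, span (map alpha s) b & x k = to_quot_exp m k b.
have hJ : is_ideal J.
  split.
  - exists 0; rewrite ?rmorph0 // => k; exists 0; first exact: ideal0.
    by rewrite rmorph0.
  - move=> u v [x hx xs] [y hy ys]; exists (x + y); first by rewrite !rmorphD hx hy.
    move=> k; have [b sb eb] := xs k; have [c sc ec] := ys k.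
    by exists (b + c); [apply: idealD|rewrite rmorphD /= -eb -ec].
  move=> r u [x hx xs]; have [y hy] := phi_surj r.
  exists (y * x); first by rewrite !rmorphM hx hy.
  move=> k; have [b sb eb] := xs k; have [c ec] := to_quot_exp_surj (y k).
  by exists (c * b); [apply: idealM|rewrite rmorphM /= -eb -ec].
have sJ : sub_ideal (span s) J.
  apply: span_sub => // x xs; exists (iota (alpha x)); first exact: lifts_s.
  by move=> k; exists (alpha x) => //; apply/mem_span/map_f.
have fJ : sub_ideal (principal f) J.
  move=> _ [r ->]; apply: idealM => //; exists 0.
    rewrite rmorph0 -(rmorph0 pi); apply/pi_eq; exists (- 1).
    by rewrite sub0r mulN1r.
  by move=> k; exists 0; [apply: ideal0|rewrite rmorph0].
have [x hx xs] := add_ideal_sub hJ sJ fJ hq.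
have ex : x = iota a by apply: (bij_inj bij_phi); rewrite hx aq.
apply: (krull_intersection noethA locA) => // k.
have [b sb] := xs k; rewrite ex => /quoP h.
exists b, (a - b); split=> //; last by rewrite addrC subrK.
exact: ideal_pow_le (leqnSn k) _ h.
Qed.

Lemma lifts_ascend a q : lifts a q ->
  span (map alpha s) a -> add_ideal (span s) (principal f) q.
Proof.
move=> aq sa; have hf := principal_ideal f.
have hS : is_ideal (add_ideal (span s) (principal f)).
  by apply: add_ideal_ideal => //; apply: span_ideal.
have hJ : is_ideal (fun a => exists2 q, lifts a q & add_ideal (span s) (principal f) q).
  split.
  - by exists 0; [apply: lifts0|apply: ideal0].
  - move=> b c [u bu su] [v cv sv]; exists (u + v); first exact: liftsD.
    exact: idealD.
  move=> b c [u bu su]; have [v bv] := lifts_total b.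
  by exists (v * u); [apply: liftsM|apply: idealM].
have [|r ar hr] := span_sub hJ _ sa.
  move=> _ /mapP[x xs ->]; exists x; first exact: lifts_s.
  by apply: add_idealL => //; apply: mem_span.
rewrite -(subrK r q); apply: idealD => //; apply: add_idealR.
  exact: span_ideal.
exact: lifts_uniq ar.
Qed.

End Descent.
End HypersurfaceLift.

(** Read from the tail, as in [regular_mod]. *)
Definition regular_seq (R : comNzRingType) (s : seq R) :=
  forall s1 w s2, s = s1 ++ w :: s2 ->
  forall a, span s2 (w * a) -> span s2 a.

(** The system found in Q is lifted to A. For regularity, a relation w a in (y2) ascends to Q, is
    cancelled there modulo f, and descends again. *)
Lemma abstract_hypersurface_system (A : comNzRingType) (m : idealr A) :
  abstract_hypersurface m ->
  exists (y : seq A) (t : A) (k : nat),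
    [/\ forall x, x \in m <-> span (t :: y) x, span y (t ^+ k) & regular_seq y].
Proof.
move=> [locA [Q [n [f [I [[locQ [D [dimD [[g0 hg0] minD]]]] _ nf hI [phi bij_phi]]]]]]].
have noethA := local_ring_noetherian locA; have noethQ := local_ring_noetherian locQ.
move: locA locQ => /local_ring_is_local locA /local_ring_is_local locQ.
have chainD := krull_dim_prime_chain dimD.
have {}hI x : x \in I <-> principal f x by rewrite hI.
have {}minD s : spans_max (mem_ideal n) s -> (D <= size s)%N.
  by move=> hs; apply: (minD (size s) _ (span_generates hs)).
have hg : spans_max (mem_ideal n) (codom g0) by apply/generates_span.
have sg : size (codom g0) = D by rewrite size_codom card_ord.
have [t [ht tG]] := lifts_generate noethA locA locQ nf hI bij_phi.
pose G q := exists a, lifts phi a q.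
have [||s [T [k [sG nsT hk regs]]]] := regular_system noethQ locQ chainD minD
  (G := G) hg sg nf _ _ ht tG.
- by exists 0; apply: lifts0.
- move=> x y j [a ax] [b bY]; exists (a - b ^+ j); apply: liftsB => //.
  exact: liftsX.
(* Off G the value 0 is a mere default that makes the lifting function total. *)
have lift x : exists a, G x -> lifts phi a x.
  by have [[a ax]|nG] := pselect (G x); [exists a|exists 0].
have [alpha halpha] := choice lift.
have ls x : x \in T :: s -> lifts phi (alpha x) x by move=> /sG[/halpha].
have lsS (s2 : seq Q) : {subset s2 <= T :: s} -> forall x, x \in s2 -> lifts phi (alpha x) x.
  by move=> h x /h /ls.
have ss : {subset s <= T :: s} by move=> x xs; rewrite inE xs orbT.
exists (map alpha s), (alpha T), k; split.
- move=> a; split=> [am|].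
    have [q aq] := lifts_total phi a.
    apply: (lifts_descend noethA locA hI bij_phi ls aq).
    apply: add_idealL; first exact: principal_ideal.
    by apply: nsT; rewrite -(lifts_max locA locQ nf hI bij_phi aq).
  move=> ha; apply: (@span_sub _ (map alpha (T :: s)) _ (idealr_is_ideal m) _ _ ha).
  move=> _ /mapP[x xs ->].
  by rewrite (lifts_max locA locQ nf hI bij_phi (ls x xs)); have [] := sG x xs.
- have := lifts_descend noethA locA hI bij_phi (lsS _ ss) (liftsX k (ls T (mem_head _ _))).
  exact.
move=> y1 w y2 e a.
have [x [s1 [s2 [es ew ey]]]] : exists x s1 s2,
    [/\ s = s1 ++ x :: s2, w = alpha x & y2 = map alpha s2].
  elim: s y1 e {sG nsT hk regs ls lsS ss} => [|x s IHs] [|z y1] //= [] e1.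
    by exists x, [::], s.
  by move=> /IHs[x' [s1 [s2 [-> -> ->]]]]; exists x', (x :: s1), s2.
rewrite ew ey => haw; have [q aq] := lifts_total phi a.
have xs : x \in s by rewrite es mem_cat mem_head orbT.
have l2 : {subset s2 <= T :: s}.
  by move=> z zs; apply: ss; rewrite es mem_cat inE zs !orbT.
apply: (lifts_descend noethA locA hI bij_phi (lsS _ l2) aq).
apply: (regs _ _ _ es).
have lx := ls x (ss _ xs).
exact: (lifts_ascend hI (lsS _ l2) (liftsM lx aq) haw).
Qed.

(** * Projective resolutions and mapping cones *)

Section Resolutions.
Variable R : comNzRingType.

Definition mk_linear (U V : lmodType R) (f : U -> V) (hf : linear f) :
  {linear U -> V} := HB.pack f (GRing.isLinear.Build R U V *:%R f hf).

Lemma projective_regular : projective (R^o : lmodType R).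
Proof.
move=> M N g f surj; have [x hx] := surj (f 1).
have lin : linear (fun a : R^o => a *: x) by move=> a u v; rewrite scalerDl scalerA.
exists (mk_linear lin) => a /=; rewrite linearZ /= hx -linearZ /=.
by congr (f _); apply: mulr1.
Qed.

Lemma projective_trivial (P : lmodType R) : (forall x : P, x = 0) -> projective P.
Proof.
move=> P0 M N g f _; have lin : linear (fun _ : P => 0 : M).
  by move=> a u v; rewrite scaler0 addr0.
by exists (mk_linear lin) => x /=; rewrite (P0 x) !linear0.
Qed.

Lemma projective_pair (P Q : lmodType R) :
  projective P -> projective Q -> projective (P * Q)%type.
Proof.
move=> hP hQ M N g f surj.
have linl : linear (fun x : P => f (x, 0)).
  move=> a u v; rewrite -linearP; congr (f _).
  by congr pair; rewrite /= scaler0 addr0.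
have linr : linear (fun x : Q => f (0, x)).
  move=> a u v; rewrite -linearP; congr (f _).
  by congr pair; rewrite /= scaler0 addr0.
have [h1 eh1] := hP M N g (mk_linear linl) surj.
have [h2 eh2] := hQ M N g (mk_linear linr) surj.
have lin : linear (fun x : P * Q => h1 x.1 + h2 x.2).
  by move=> a u v /=; rewrite !linearP scalerDr addrACA.
exists (mk_linear lin) => -[x y] /=; rewrite linearD eh1 eh2 /= -linearD.
by congr (f _); congr pair; rewrite /= ?addr0 ?add0r.
Qed.

(* A finite projective resolution of R / I; the augmentation e is lifted to R *)
(* so that I is allowed not to be proper.                                     *)
Definition has_resolution (I : R -> Prop) : Prop :=
  exists (n : nat) (P : nat -> lmodType R)
         (d : forall i, {linear P i.+1 -> P i}) (e : {linear P 0%N -> R^o}),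
    [/\ forall i, projective (P i),
        forall i, (n < i)%N -> forall x : P i, x = 0,
        forall y, exists x, e x = y,
        forall x, I (e x) <-> exists y, d 0%N y = x
      & forall i x, d i x = 0 <-> exists y, d i.+1 y = x].

Lemma has_resolution0 (I : R -> Prop) : (forall x, I x <-> x = 0) -> has_resolution I.
Proof.
move=> hI.
pose P i : lmodType R := if i is _.+1 then 'rV[R]_0 : lmodType R else R^o.
have P0 i (x : P i.+1) : x = 0 by apply: thinmx0.
have lin0 i : linear (fun _ : P i.+1 => 0 : P i).
  by move=> a u v; rewrite scaler0 addr0.
have lin1 : linear (fun x : P 0%N => x : R^o) by [].
exists 0%N, P, (fun i => mk_linear (lin0 i)), (mk_linear lin1); split.
- move=> [|i]; first exact: projective_regular.
  exact/projective_trivial/P0.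
- by case.
- by move=> y; exists y.
- move=> x; rewrite hI; split=> [x0|[y <-] //].
  by exists 0; symmetry; apply: x0.
by move=> i x; split=> // _; exists 0; rewrite (P0 i x).
Qed.

Section MappingCone.
Variables (P : nat -> lmodType R) (d : forall i, {linear P i.+1 -> P i}) (w : R).

(** The terms of the mapping cone of multiplication by w on P; the sign in [cone_diffS_linear] makes
    consecutive differentials compose to zero. *)
Definition cone i : lmodType R :=
  if i is i'.+1 then (P i'.+1 * P i')%type else P 0%N.

Lemma cone_diff0_linear : linear (fun x : P 1%N * P 0%N => d 0%N x.1 + w *: x.2).
Proof.
move=> a u v /=; rewrite linearP !scalerDr !scalerA [a * w]mulrC.
by rewrite addrACA.
Qed.

Lemma cone_diffS_linear i :
  linear (fun x : P i.+2 * P i.+1 => (d i.+1 x.1 + w *: x.2, - d i x.2)).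
Proof.
move=> a u v; congr pair => /=; last by rewrite linearP opprD scalerN.
by rewrite linearP !scalerDr !scalerA [a * w]mulrC addrACA.
Qed.

Definition cone_diff i : {linear cone i.+1 -> cone i} :=
  match i return {linear cone i.+1 -> cone i} with
  | 0%N => @mk_linear (cone 1) (cone 0) _ cone_diff0_linear
  | i'.+1 => @mk_linear (cone i'.+2) (cone i'.+1) _ (@cone_diffS_linear i')
  end.

End MappingCone.

(** The cone resolves R/(I + (w)) because multiplication by w is injective on R/I; this injectivity
    is what gives exactness in degree 1. *)
Lemma has_resolution_cone (I J : R -> Prop) w : is_ideal I ->
  (forall a, I (w * a) -> I a) ->
  (forall x, J x <-> exists r b, I b /\ x = r * w + b) ->
  has_resolution I -> has_resolution J.
Proof.
move=> hI regw hJ [n [P [d [e [projP Pn esurj exact0 exactS]]]]].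
exists n.+1, (cone P), (cone_diff d w), e; split=> //.
- case=> [|i]; first exact: projP.
  exact: projective_pair.
- case=> // i ni [x y]; congr pair; apply: Pn => //; exact: ltnW.
- move=> x; rewrite hJ; split=> [[r [b [Ib ex]]]|[[y z] <-]].
    have [z ez] := esurj r.
    have /exact0[y ey] : I (e (x - w *: z)).
      rewrite linearB linearZ ez ex /= (_ : r * w + b - w *: (r : R^o) = b) //.
      by rewrite -[w *: _]/(w * r) mulrC addrC addKr.
    by exists (y, z); rewrite /= ey subrK.
  exists (e z), (e (d 0%N y)); split; first by apply/exact0; exists y.
  by rewrite /= linearD linearZ /= addrC [e z * w]mulrC.
case=> [|i] [x y]; split.
- move=> /= exy.
  (* A cycle (x, y) has w e(y) = - e(d x) in I, so e(y) is in I by regularity and y is a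
     boundary. *)
  have [z ez] : exists z, d 0%N z = y.
    apply: (exact0 _).1; apply: regw; have -> : w * e y = - e (d 0%N x).
      apply/eqP; rewrite -subr_eq0 opprK addrC; apply/eqP.
      by have := congr1 e exy; rewrite linearD linearZ linear0.
    by apply: (idealN hI); apply: (exact0 _).2; exists x.
  have /exactS[u eu] : d 0%N (x + w *: z) = 0 by rewrite linearD linearZ /= ez.
  by exists (u, - z) => /=; rewrite eu scalerN addrK linearN opprK ez.
- move=> [[u v] /= [<- <-]].
  rewrite linearD linearZ /= scalerN addrK; exact/exactS/ex_intro.
- move=> /= [exy /eqP]; rewrite oppr_eq0 => /eqP /exactS[z ez].
  have /exactS[u eu] : d i.+1 (x + w *: z) = 0 by rewrite linearD linearZ /= ez.
  by exists (u, - z) => /=; rewrite eu scalerN addrK linearN opprK ez.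
move=> [[u v] /= [<- <-]]; congr pair.
  rewrite linearD linearZ /= scalerN addrK; exact/exactS/ex_intro.
by rewrite linearN (_ : d i (d i.+1 v) = 0) ?oppr0 //; apply/exactS; exists v.
Qed.

(** The iterated cones, starting from R in degree 0, form the Koszul complex of s. *)
Lemma regular_seq_resolution s : regular_seq s -> has_resolution (span s).
Proof.
elim: s => [|w s IHs] regs.
  apply: has_resolution0 => x; split=> [/span_nil //|->].
  exact: (ideal0 (span_ideal [::])).
apply: (@has_resolution_cone (span s) _ w); first exact: span_ideal.
- exact: (regs [::] w s erefl).
- by move=> x; rewrite span_cons.
by apply: IHs => s1 v s2 es; apply: (regs (w :: s1)); rewrite es.
Qed.

End Resolutions.

(** * The cyclic module R/I and its uniserial case *)

Definition quotient_module (R : comNzRingType) (I : idealr R) : Type := {ideal_quot I}.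

Section QuotientModule.
Variables (R : comNzRingType) (I : idealr R).
Local Notation M := (quotient_module I).
Local Notation pi := (\pi_({ideal_quot I})%qT : R -> {ideal_quot I}).

HB.instance Definition _ := GRing.Zmodule.copy M {ideal_quot I}.

Definition quotient_scale (a : R) (x : M) : M := pi a * (x : {ideal_quot I}).

Fact quotient_scaleA a b x :
  quotient_scale a (quotient_scale b x) = quotient_scale (a * b) x.
Proof. by rewrite /quotient_scale rmorphM mulrA. Qed.

Fact quotient_scale1 : left_id 1 quotient_scale.
Proof. by move=> x; rewrite /quotient_scale rmorph1 mul1r. Qed.

Fact quotient_scaleDr : right_distributive quotient_scale +%R.
Proof. by move=> a x y; apply: mulrDr. Qed.

Fact quotient_scaleDl x : {morph quotient_scale^~ x : a b / a + b}.
Proof. by move=> a b; rewrite /quotient_scale rmorphD; apply: mulrDl. Qed.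

HB.instance Definition _ := GRing.Zmodule_isLmodule.Build R M
  quotient_scaleA quotient_scale1 quotient_scaleDr quotient_scaleDl.

Definition quotient_proj (a : R) : M := pi a.
Local Notation p := quotient_proj.

Lemma quotient_projM a b : p (a * b) = a *: p b.
Proof. exact: rmorphM. Qed.

Lemma quotient_proj_linear : linear (p : R^o -> M).
Proof. by move=> a x y; rewrite -quotient_projM; apply: rmorphD. Qed.

Lemma quotient_proj_eq a b : p a = p b <-> a - b \in I.
Proof. by rewrite (Quotient.idealrBE I); split=> [e|/eqP//]; apply/eqP; exact: e. Qed.

Lemma quotient_proj_eq0 a : p a = 0 <-> a \in I.
Proof.
have -> : 0 = p 0 by symmetry; apply: (rmorph0 pi).
by rewrite quotient_proj_eq subr0.
Qed.

Lemma quotient_proj_surj (x : M) : exists a, x = p a.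
Proof. by exists (repr (x : {ideal_quot I})); rewrite /quotient_proj reprK. Qed.

Lemma quotient_finite_projective_dim :
  has_resolution (fun x => x \in I) -> finite_projective_dim M.
Proof.
move=> [n [P [d [e [projP Pn esurj exact0 exactS]]]]].
have lin : linear (fun x => p (e x)).
  by move=> a x y; rewrite linearP; apply: quotient_proj_linear.
exists n, P, d, (mk_linear lin); split=> // [y|x] /=.
  have [a ->] := quotient_proj_surj y; have [x <-] := esurj a.
  by exists x.
by rewrite quotient_proj_eq0.
Qed.

Section Uniserial.
Variables (m : idealr R) (t : R) (l : nat).
Hypothesis locR : is_local (fun x => x \in m).
Hypothesis tm : t \in m.
Hypothesis mt : forall x, x \in m -> exists r, x - r * t \in I.
Hypothesis tl : t ^+ l \in I.
Hypothesis lmin : forall k, t ^+ k \in I -> (l <= k)%N.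

(** A factor t is extracted from the coefficient as long as it lies in m; the process stops early
    exactly at a unit. *)
Lemma uniserial_expand k a : (exists r, a - r * t ^+ k \in I) \/
  exists j u, [/\ (j < k)%N, u \notin m & a - u * t ^+ j \in I].
Proof.
elim: k => [|k [[r hr]|[j [u [jk um hu]]]]]; last 1 first.
- by right; exists j, u; split=> //; apply: leqW.
- by left; exists a; rewrite expr0 mulr1 subrr rpred0.
have [/mt[c hc]|rm] := boolP (r \in m); last by right; exists k, r.
left; exists c.
have -> : a - c * t ^+ k.+1 = a - r * t ^+ k + t ^+ k * (r - c * t).
  by rewrite exprS; ring.
by rewrite rpredD // idealMr.
Qed.

Lemma uniserial_proj a : a \notin I -> exists j u b,
  [/\ (j < l)%N, p a = u *: p (t ^+ j) & p (t ^+ j) = b *: p a].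
Proof.
move=> aI; have [[r hr]|[j [u [jl um hu]]]] := uniserial_expand l a.
  case/negP: aI; rewrite -(subrK (r * t ^+ l) a) rpredD //.
  exact: idealMr.
have e : p a = u *: p (t ^+ j) by rewrite -quotient_projM; apply/quotient_proj_eq.
have [b bu] := local_unit locR (elimN idP um).
by exists j, u, b; split; rewrite // e scalerA bu scale1r.
Qed.

(** The submodules generated by t^l, ..., t, 1 form a chain of length l, and in any chain the i-th
    member must already contain t^(l-i). *)
Lemma uniserial_length : has_length M l.
Proof.
split.
  pose c i : {pred M} := fun x => `[< exists r : R, x = r *: p (t ^+ (l - i)) >].
  have cP i x : x \in c i <-> exists r : R, x = r *: p (t ^+ (l - i)).
    by split=> [/asboolP|h] //; apply/asboolP.
  exists c; split=> i il.
    split; first by apply/cP; exists 0; rewrite scale0r.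
    move=> a x y /cP[r ->] /cP[s ->]; apply/cP; exists (a * r + s).
    by rewrite scalerDl scalerA.
  have e : (l - i = (l - i.+1).+1)%N by lia.
  split.
    move=> x /cP[r ->]; apply/cP; exists (r * t).
    by rewrite e exprS quotient_projM scalerA.
  move=> /(_ (p (t ^+ (l - i.+1)))) h.
  have /h /cP[r] : p (t ^+ (l - i.+1)) \in c i.+1.
    by apply/cP; exists 1; rewrite scale1r.
  rewrite -quotient_projM => /quotient_proj_eq; rewrite e exprS.
  have -> : t ^+ (l - i.+1) - r * (t * t ^+ (l - i.+1)) =
      (1 - r * t) * t ^+ (l - i.+1) by ring.
  (* As 1 - r t is a unit, a failure of strictness would put a power of t below the l-th in I. *)
  move=> htj; have : t ^+ (l - i.+1) \in I.
    have rtm : ~ (1 - r * t \in m).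
      move=> h1; have := idealr1 m; rewrite -(subrK (r * t) 1) rpredD //.
      exact: idealMr.
    have [u hu] := local_unit locR rtm.
    by rewrite -[X in X \in _]mul1r -hu -mulrA idealMr.
  by move=> /lmin; lia.
move=> k [c [csub cS]].
suff h i : (i <= k)%N -> (i <= l)%N /\ p (t ^+ (l - i)) \in c i by case: (h k).
elim: i => [|i IHi] ik.
  split=> //; rewrite subn0; have /quotient_proj_eq0 -> := tl.
  by case: (csub 0%N ik).
have [il hi] := IHi (ltnW ik); have [c0 clin] := csub i (ltnW ik).
have [d0 dlin] := csub i.+1 ik; have [sub nsub] := cS i ik.
have cZ a x : x \in c i -> a *: x \in c i.
  by move=> hx; rewrite -[a *: x]addr0; apply: clin.
have dZ a x : x \in c i.+1 -> a *: x \in c i.+1.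
  by move=> hx; rewrite -[a *: x]addr0; apply: dlin.
have [x xd xc] : exists2 x, x \in c i.+1 & x \notin c i.
  apply: contrapT => h; apply: nsub => x xd; apply: contraT => xc.
  by case: h; exists x.
have [a ea] := quotient_proj_surj x; rewrite {}ea in xd xc.
have aI : a \notin I by apply: contra xc => /quotient_proj_eq0 ->.
have [j [u [b [jl ea eb]]]] := uniserial_proj aI.
(* The new element is a unit times t^j; an exponent j of at least l - i would place it in c i
   already. *)
have ji : (j < l - i)%N.
  rewrite ltnNge; apply: contra xc => ij.
  by rewrite ea -(subnK ij) exprD quotient_projM; exact: cZ (cZ _ _ hi).
split; first by lia.
have -> : (l - i.+1 = l - i.+1 - j + j)%N by lia.
by rewrite exprD quotient_projM eb; exact: dZ (dZ _ _ xd).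
Qed.

(** Since m = (t) modulo I, m^l lies in I + (t^l) = I; conversely, if m^k kills R/I then t^k is in
    I. *)
Lemma uniserial_loewy_length : loewy_length m M l.
Proof.
split=> [a v|k ann].
  move=> /ideal_expP ha; suff [r hr] : exists r, a - r * t ^+ l \in I.
    have aI : a \in I by rewrite -(subrK (r * t ^+ l) a) rpredD // idealMr.
    have [b ->] := quotient_proj_surj v.
    by rewrite -quotient_projM; apply/quotient_proj_eq0; rewrite mulrC idealMr.
  have hJ k : is_ideal (fun a => exists r, a - r * t ^+ k \in I).
    split.
    - by exists 0; rewrite mul0r subr0 rpred0.
    - move=> x y [r hr] [s hs]; exists (r + s).
      by rewrite mulrDl opprD addrACA rpredD.
    - move=> b x [r hr]; exists (b * r).
      by rewrite -mulrA -mulrBr idealMr.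
  elim: l a ha => [|k IHk] a ha.
    by exists a; rewrite expr0 mulr1 subrr rpred0.
  apply: (ideal_gen_sub (hJ k.+1) _ ha) => _ [b [c [bm /IHk[r hr] ->]]].
  have [s hs] := mt bm; exists (s * r).
  have -> : b * c - s * r * t ^+ k.+1 =
      b * (c - r * t ^+ k) + r * t ^+ k * (b - s * t) by rewrite exprS; ring.
  by rewrite rpredD // idealMr.
apply: lmin; apply/quotient_proj_eq0.
rewrite -[t ^+ k]mulr1 quotient_projM; apply: ann.
by apply/ideal_expP; apply: ideal_pow_exp.
Qed.

End Uniserial.
End QuotientModule.

Theorem proposition1p2 (A : comNzRingType) (m : idealr A)
    (hA : abstract_hypersurface m)
    (d : nat) (hd : krull_dim A d) (d_gt0 : (0 < d)%N) :
  exists M : lmodType A,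
    [/\ exists x : M, x != 0,
        finite_projective_dim M
      & exists l : nat, has_length M l /\ loewy_length m M l].
Proof.
have [y [t [k [my tk regy]]]] := abstract_hypersurface_system hA.
have locA := local_ring_is_local hA.1.
have ym : sub_ideal (span y) (fun x => x \in m).
  by move=> x xy; apply/my; apply: span_mono xy => z zy; rewrite inE zy orbT.
have tm : t \in m by apply/my/mem_span/mem_head.
have [|I hI] := is_ideal_idealr (span_ideal y).
  by move=> /ym; rewrite idealr1.
have ex : exists l, t ^+ l \in I by exists k; apply/hI.
(* This least exponent is the common value of length and Loewy length. *)
have [l tl lmin] := ex_minnP ex.
have mt x : x \in m -> exists r, x - r * t \in I.
  by move=> /my /span_cons[r [b [yb ->]]]; exists r; rewrite addrC addKr; apply/hI.
exists (quotient_module I); split.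
- exists (quotient_proj I 1); apply/eqP => /quotient_proj_eq0.
  by rewrite idealr1.
- apply: quotient_finite_projective_dim.
  have -> : (fun x => is_true (x \in I)) = span y.
    by apply/funext => x; apply/propext/hI.
  exact: regular_seq_resolution.
exists l; split; first exact: uniserial_length locA tm mt tl lmin.
exact: uniserial_loewy_length tm mt tl lmin.
Qed.
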